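(* Let $A\in\mathbb{Z}^{m\times n_x}$, $B\in\mathbb{Q}^{m\times n_y}$, $b\in\mathbb{Q}^m$ and $\mathcal{P}=\{(x,y):Ax\le b+By\}$. Then there exists a chamber decomposition $\mathcal{Q}\mathcal{S}$ of $\mathcal{P}$ such that, for any fixed $\mathcal{Q}\in\mathcal{Q}\mathcal{S}$ corresponding to a bounded $\mathcal{P}_y$ and all $y\in\operatorname{relint}(\mathcal{Q})$, $c_{\mathcal{P}}$ is represented by a quasi-polynomial of degree $n_x$: $$c_{\mathcal{P}}(y)=\sum_{\mathbf{j}\in\mathbb{Z}_{\ge0}^{n_y},\ \|\mathbf{j}\|_1\le n_x}a_{\mathbf{j}}(y)\,y^{\mathbf{j}},$$ with periodic coefficients $a_{\mathbf{j}}$, such that: (1) the vector $\operatorname{chdenom}_{\mathbb{Q}}(\mathcal{Q})\cdot\mathbf{1}$ can be chosen as a period-vector of all $a_{\mathbf{j}}$; (2) for any $y\in\mathcal{Q}$ and $z\in\operatorname{relint}(\mathcal{Q})$, with $q=\operatorname{lcm}\bigl(\operatorname{denom}_{\mathbb{Q}}(\mathcal{P}_y),\operatorname{denom}_{\mathbb{Q}}(\mathcal{P}_z)\bigr)$, one has $a_{\mathbf{j}}(y)=a_{\mathbf{j}}(y+q(z-y))$.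
   Context: $\mathcal{P}_y=\{x\in\mathbb{R}^{n_x}:(x,y)\in\mathcal{P}\}$, $c_{\mathcal{P}}(y)=|\mathcal{P}_y\cap\mathbb{Z}^{n_x}|$, $\Pi(x,y)=y$. A base is a set $\mathcal{B}$ of $n_x$ row indices with $A_{\mathcal{B}}$ nonsingular. A chamber decomposition of $\mathcal{P}$ is a finite collection $\mathcal{Q}\mathcal{S}$ of rational polyhedra in $\mathbb{R}^{n_y}$ whose relative interiors are pairwise disjoint and cover $\Pi(\mathcal{P})$, such that for each $\mathcal{Q}$ all $\mathcal{P}_y$, $y\in\operatorname{relint}(\mathcal{Q})$, have the same combinatorial type, and there is a set $\operatorname{base}(\mathcal{Q})$ of bases with $\operatorname{vert}(\mathcal{P}_y)=\{\mathcal{V}_{\mathcal{B}}(y):=A_{\mathcal{B}}^{-1}(b_{\mathcal{B}}+B_{\mathcal{B}}y):\mathcal{B}\in\operatorname{base}(\mathcal{Q})\}$ for $y\in\operatorname{relint}(\mathcal{Q})$. $\operatorname{chdenom}_{\mathbb{Q}}(\mathcal{Q})$ is the minimal $q\in\mathbb{Q}_{>0}$ with $q\mathcal{V}_{\mathcal{B}}(y)\in\mathbb{Z}^{n_x}$ for all $y\in\mathbb{Z}^{n_y}$, $\mathcal{B}\in\operatorname{base}(\mathcal{Q})$. For a rational polyhedron $\mathcal{R}$, $\operatorname{denom}_{\mathbb{Q}}(\mathcal{R})$ is the minimal $q\in\mathbb{Q}_{>0}$ with $\operatorname{vert}(q\mathcal{R})$ integral. A function $g$ on $\mathbb{R}^{n_y}$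 is periodic if there is a matrix $P$ with linearly independent columns such that $g(u)=g(v)$ whenever $u-v\in P\mathbb{Z}^r$; $p$ is a period-vector if $\operatorname{diag}(p)$ is such a matrix. *)

(* Defs.v *)
From HB Require Import structures.
From mathcomp Require Import all_boot all_order all_algebra finmap.
From mathcomp Require Import all_classical all_reals all_analysis.
Set Implicit Arguments.
Unset Strict Implicit.
Unset Printing Implicit Defensive.
Import Order.TTheory GRing.Theory Num.Theory.
Import numFieldNormedType.Exports.
Local Open Scope classical_set_scope.
Local Open Scope ring_scope.

Definition Zvec (R : realType) (n : nat) : set 'cV[R]_n :=
  [set x | x \is a mxOver Num.int].

Section convex_geometry.
Context {R : realType} {n : nat}.
Implicit Types (S T F : set 'cV[R]_n).

Definition affine_hull S : set 'cV[R]_n :=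
  [set x | exists (k : nat) (w : 'I_k -> R) (p : 'I_k -> 'cV[R]_n),
     [/\ forall i, S (p i), \sum_i w i = 1 & x = \sum_i w i *: p i]].

Definition relint S : set 'cV[R]_n :=
  [set x | S x /\ within (affine_hull S) (nbhs x) S].

Definition rational_polyhedron S : Prop :=
  exists (k : nat) (C : 'M[rat]_(k, n)) (d : 'cV[rat]_k),
    S = [set y | forall i, (map_mx ratr C *m y) i 0 <= ratr (d i 0)].

(* The improper faces are included: [u = 0] gives set0 ([t = 1]) and S itself
   ([t = 0]). *)
Definition face S F : Prop :=
  exists (u : 'rV[R]_n) (t : R),
    (forall x, S x -> (u *m x) 0 0 <= t) /\
    F = [set x | S x /\ (u *m x) 0 0 = t].

Definition vert S : set 'cV[R]_n := [set v | face S [set v]].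

(* The face lattices, ordered by inclusion, are isomorphic. *)
Definition same_combinatorial_type S T : Prop :=
  exists phi : set 'cV[R]_n -> set 'cV[R]_n,
    set_bij (face S) (face T) phi /\
    forall F G, face S F -> face S G -> (F `<=` G <-> phi F `<=` phi G).

(* [q] is the denominator of [S].  This is a relation because the minimum need
   not exist, e.g. if all vertices are 0 or if some vertex is irrational. *)
Definition is_denom S (q : rat) : Prop :=
  let D := [set r : rat | 0 < r /\
              vert ((fun x => ratr r *: x) @` S) `<=` @Zvec R n] in
  D q /\ lbound D q.

End convex_geometry.

Definition is_lcmq (p q r : rat) : Prop :=
  let M := [set s : rat | [/\ 0 < s, s / p \is a Num.int
                            & s / q \is a Num.int]] in
  M r /\ lbound M r.

Section bases.
Context {F : fieldType} {m n : nat}.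

Definition base_row (I : {set 'I_m}) (cI : #|I| = n) (k : 'I_n) : 'I_m :=
  enum_val (cast_ord (esym cI) k).

Record base (A : 'M[F]_(m, n)) := Base {
  base_set : {set 'I_m};
  base_card : #|base_set| = n;
  base_unit : rowsub (base_row base_card) A \in unitmx }.

Definition rows_of (A : 'M[F]_(m, n)) (I : base A) : 'I_n -> 'I_m :=
  base_row (base_card I).

End bases.

Section parametric_polyhedra.
Context {R : realType} {m nx ny : nat}.
Variables (A : 'M[R]_(m, nx)) (B : 'M[R]_(m, ny)) (b : 'cV[R]_m).

Definition param_polyhedron : set ('cV[R]_nx * 'cV[R]_ny) :=
  [set xy | forall i, (A *m xy.1) i 0 <= (b + B *m xy.2) i 0].

Definition fiber (y : 'cV[R]_ny) : set 'cV[R]_nx :=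
  [set x | param_polyhedron (x, y)].

(* [fset_set] sends infinite sets to the empty one: this is the number of
   integer points only if that number is finite, e.g. if the fiber is
   bounded. *)
Definition count_points (y : 'cV[R]_ny) : nat :=
  #|` fset_set (fiber y `&` @Zvec R nx)|%fset.

Definition base_vertex (I : base A) (y : 'cV[R]_ny) : 'cV[R]_nx :=
  invmx (rowsub (rows_of I) A) *m
  (rowsub (rows_of I) b + rowsub (rows_of I) B *m y).

(* [bases Q] is the set base(Q) attached to the chamber Q. *)
Definition chamber_decomposition (QS : set (set 'cV[R]_ny))
    (bases : set 'cV[R]_ny -> set (base A)) : Prop :=
  [/\ finite_set QS /\ (forall Q, QS Q -> rational_polyhedron Q),
      trivIset QS relint,
      snd @` param_polyhedron `<=` \bigcup_(Q in QS) relint Q,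
      (forall Q, QS Q -> forall y z, relint Q y -> relint Q z ->
         same_combinatorial_type (fiber y) (fiber z))
    & (forall Q, QS Q -> forall y, relint Q y ->
         vert (fiber y) = [set base_vertex I y | I in bases Q])].

(* A relation for the same reason as [is_denom]: there is no minimum if all
   the [base_vertex I] vanish identically. *)
Definition is_chdenom (Is : set (base A)) (q : rat) : Prop :=
  let D := [set r : rat | 0 < r /\ forall y I, @Zvec R ny y -> Is I ->
              @Zvec R nx (ratr r *: base_vertex I y)] in
  D q /\ lbound D q.

End parametric_polyhedra.

Section quasi_polynomials.
Context {R : realType} {n : nat}.
Implicit Types (g : 'cV[R]_n -> R).

Definition period_matrix (r : nat) (P : 'M[R]_(n, r)) g : Prop :=
  \rank P = r /\
  forall u v, (exists2 k : 'cV[R]_r, Zvec k & u - v = P *m k) -> g u = g v.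

Definition is_periodic g : Prop :=
  exists (r : nat) (P : 'M[R]_(n, r)), period_matrix P g.

Definition period_vector (p : 'rV[R]_n) g : Prop := period_matrix (diag_mx p) g.

(* The multi-indices in n variables of total degree at most d; a single
   exponent is then at most d. *)
Definition multi_index (d : nat) : finType :=
  {j : {ffun 'I_n -> 'I_d.+1} | (\sum_i j i <= d)%N}.

Definition monomial (d : nat) (j : multi_index d) (y : 'cV[R]_n) : R :=
  \prod_i y i 0 ^+ (val j i).

End quasi_polynomials.
Arguments multi_index n d : clear implicits.

(* Main.v *)
Require Import Defs.
From HB Require Import structures.
From mathcomp Require Import all_boot all_order all_algebra finmap.
From mathcomp Require Import all_classical all_reals all_analysis.
From mathcomp Require Import ring lra zify.
Set Implicit Arguments.
Unset Strict Implicit.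
Unset Printing Implicit Defensive.
Import Order.TTheory GRing.Theory Num.Theory.
Import numFieldNormedType.Exports.
Local Open Scope classical_set_scope.
Local Open Scope ring_scope.

(** Write [beta y = b + B y]. Fourier-Motzkin elimination yields finitely
    many rational affine forms in [y] whose signs determine which
    constraints can be simultaneously tight, strict or violated in the fiber
    over [y]. The chambers are the closed cells of the corresponding
    hyperplane arrangement; the signs determine the face lattice of the
    fiber and its feasible bases.

    Fix a chamber with bounded fibers and a generic integral functional
    [xi]. Shooting a line in an integral direction [w] with [xi w > 0]
    through a point of the fiber and recording where it enters and leaves
    the fiber reduces the indicator function of the fiber to those of its
    facets. By recursion it becomes a signed sum of half-open simplicial
    cones, with apex a vertex [V_I y] and with fixed integral generators [g]
    such that [xi g > 0]. The number of lattice points [x] of such a cone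
    with [xi x <= M] is a quasi-polynomial in [M], and moving the apex by an
    integral vector [s] replaces [M] by [M - xi s]. The signed sum of these
    functions is the number of lattice points of the fiber for all large
    [M], so only their polynomial parts contribute: on each class of
    parameters with the same vertices modulo the lattice the count is a
    polynomial in [y]. The coefficients are therefore constant on these
    classes, which implies both periodicity claims. *)

(** * Polynomials in the shift operator *)

Section shift_operators.
Context {R : numFieldType}.
Implicit Types (p q : {poly R}) (f g : int -> R) (M : int).

(** The action of [p] on functions of an integer in which ['X] is the shift [M -> M + 1]. Only
    values of [f] at arguments [>= M] enter, so that identities may be required for large [M]
    only. *)
Definition shift_poly p f M : R := \sum_(i < size p) p`_i * f (M + i%:Z).

Lemma shift_poly_widen N p f M : (size p <= N)%N ->
  shift_poly p f M = \sum_(i < N) p`_i * f (M + i%:Z).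
Proof.
move=> leN; rewrite /shift_poly.
rewrite (big_ord_widen N (fun i => p`_i * f (M + i%:Z)) leN) big_mkcond /=.
apply: eq_bigr => i _; case: ifP => // /negbT; rewrite -leqNgt => /leq_sizeP.
by move=> /(_ i (leqnn i)) ->; rewrite mul0r.
Qed.

Lemma shift_polyD p q f M :
  shift_poly (p + q) f M = shift_poly p f M + shift_poly q f M.
Proof.
pose N := maxn (size p) (size q).
rewrite !(@shift_poly_widen N) ?leq_maxl ?leq_maxr ?size_polyD// -big_split /=.
by apply: eq_bigr => i _; rewrite coefD mulrDl.
Qed.

Lemma shift_polyZ c p f M : shift_poly (c *: p) f M = c * shift_poly p f M.
Proof.
rewrite !(@shift_poly_widen (size p)) ?size_scale_leq// mulr_sumr.
by apply: eq_bigr => i _; rewrite coefZ mulrA.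
Qed.

Lemma shift_polyC c f M : shift_poly c%:P f M = c * f M.
Proof.
by rewrite (@shift_poly_widen 1) ?size_polyC_leq1// big_ord1 coefC eqxx addr0.
Qed.

Lemma shift_polyMX p f M : shift_poly (p * 'X) f M = shift_poly p f (M + 1).
Proof.
rewrite (@shift_poly_widen (size p).+1) ?(leq_trans (size_polyMleq _ _))//;
  last by rewrite size_polyX addn2.
rewrite big_ord_recl coefMX eqxx mul0r add0r; apply: eq_bigr => i _.
by rewrite coefMX /= /bump /= add1n -addrA -PoszD add1n.
Qed.

Lemma shift_polyM p q f M :
  shift_poly (p * q) f M = shift_poly p (shift_poly q f) M.
Proof.
elim/poly_ind: p M => [|p c IH] M.
  by rewrite mul0r /shift_poly size_poly0 !big_ord0.
rewrite mulrDl mulrAC mul_polyC !shift_polyD shift_polyZ shift_polyC.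
by rewrite !shift_polyMX IH.
Qed.

Lemma eq_shift_poly p f g M : (forall N, M <= N -> f N = g N) ->
  shift_poly p f M = shift_poly p g M.
Proof. by move=> fg; apply: eq_bigr => i _; rewrite fg// lerDl. Qed.

Lemma shift_poly_eq0 p f M : (forall N, M <= N -> f N = 0) ->
  shift_poly p f M = 0.
Proof. by move=> f0; apply: big1 => i _; rewrite f0 ?mulr0// lerDl. Qed.

Lemma shift_polyXn k f M : shift_poly 'X^k f M = f (M + k%:Z).
Proof.
elim: k M => [|k IH] M; first by rewrite shift_polyC mul1r addr0.
by rewrite exprSr shift_polyMX IH -addrA -PoszD add1n.
Qed.

Lemma shift_polyXnB1 k f M :
  shift_poly ('X^k - 1) f M = f (M + k%:Z) - f M.
Proof.
by rewrite shift_polyD shift_polyXn -scaleN1r shift_polyZ shift_polyC mul1r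
  mulN1r.
Qed.

Lemma shift_poly_cst p c M : shift_poly p (fun=> c) M = p.[1] * c.
Proof.
rewrite /shift_poly -mulr_suml horner_coef; congr (_ * _).
by apply: eq_bigr => i _; rewrite expr1n mulr1.
Qed.

Lemma shift_poly_sum (I : finType) p (f : I -> int -> R) (s : I -> int) M :
  shift_poly p (fun N => \sum_t f t (N - s t)) M =
  \sum_t shift_poly p (f t) (M - s t).
Proof.
rewrite /shift_poly exchange_big /=; apply: eq_bigr => i _.
by rewrite mulr_sumr; apply: eq_bigr => t _; rewrite addrAC.
Qed.

(** Newton's forward difference formula: the first difference of [g] is killed by one factor less,
    and its expansion is summed by Pascal's rule. *)
Lemma newton_series d g (M0 : int) :
  (forall M, M0 <= M -> shift_poly (('X - 1) ^+ d) g M = 0) ->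
  exists c : nat -> R, forall j : nat,
    g (M0 + j%:Z) = \sum_(k < d) c k * 'C(j, k)%:R.
Proof.
elim: d g => [|d IH] g gE.
  exists (fun=> 0) => j; rewrite big_ord0 -[RHS](gE (M0 + j%:Z)) ?lerDl//.
  by rewrite expr0 shift_polyC mul1r.
have {}gE M : M0 <= M ->
    shift_poly (('X - 1) ^+ d) (fun N => g (N + 1) - g N) M = 0.
  move=> leM; rewrite -[RHS](gE M leM) exprSr shift_polyM.
  by apply: eq_shift_poly => N _; rewrite -['X]expr1 shift_polyXnB1.
have [c cE] := IH _ gE.
exists (fun k => if k is k'.+1 then c k' else g M0).
elim=> [|j IHj].
  rewrite big_ord_recl /= big1 ?bin0 ?mulr1 ?addr0// => i _.
  by rewrite bin0n mulr0.
have -> : M0 + j.+1%:Z = M0 + j%:Z + 1 by rewrite -addrA -PoszD addn1.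
rewrite -(subrK (g (M0 + j%:Z)) (g _)) cE IHj !big_ord_recl /= !bin0 addrCA.
congr (_ + _); rewrite -big_split /=; apply: eq_bigr => i _.
by rewrite -mulrDr /bump /= add1n add0n binS natrD [X in _ * X]addrC.
Qed.

Lemma binomial_poly k : exists p : {poly R}, (size p <= k.+1)%N /\
  forall j : nat, p.[j%:R] = 'C(j, k)%:R.
Proof.
elim: k => [|k [p [sp pE]]].
  by exists 1; rewrite size_poly1; split=> // j; rewrite hornerC bin0.
exists (k.+1%:R^-1 *: (p * ('X - k%:R%:P))); split=> [|j].
  rewrite (leq_trans (size_scale_leq _ _))// (leq_trans (size_polyMleq _ _))//.
  by rewrite size_XsubC addn2.
rewrite hornerZ hornerM pE hornerXsubC.
have k0 : k.+1%:R != 0 :> R by rewrite pnatr_eq0.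
apply: (mulfI k0); rewrite mulVKf//.
(* The subtraction [j - k] in [mul_bin_left] is truncated; for [j < k] both binomials vanish. *)
have [ltjk|lekj] := ltnP j k; first by rewrite !bin_small ?mul0r ?mulr0// ltnW.
by rewrite -natrB// -!natrM mul_bin_left mulnC.
Qed.

Lemma shift_poly_kernel d g (M0 : int) :
  (forall M, M0 <= M -> shift_poly (('X - 1) ^+ d) g M = 0) ->
  exists p : {poly R}, (size p <= d)%N /\
    forall M, M0 <= M -> g M = p.[M%:~R].
Proof.
move=> /newton_series [c cE].
have [b bE] := choice binomial_poly.
pose p := \sum_(k < d) c k *: b k.
exists (p \Po ('X - M0%:~R%:P)); split.
  rewrite size_comp_poly2 ?size_XsubC//.
  apply: (leq_trans (size_sum _ _ _)); apply/bigmax_leqP => k _.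
  by rewrite (leq_trans (size_scale_leq _ _))// (leq_trans (bE k).1).
move=> M leM; have [j ->] : exists j : nat, M = M0 + j%:Z.
  by exists `|M - M0|%N; rewrite gez0_abs ?subr_ge0// addrCA subrr addr0.
rewrite cE horner_comp hornerXsubC rmorphD /= addrC addKr horner_sum.
by apply: eq_bigr => k _; rewrite hornerZ (bE k).2.
Qed.

Lemma poly_eq0_large (p : {poly R}) (M0 : int) :
  (forall M, M0 <= M -> p.[M%:~R] = 0) -> p = 0.
Proof.
move=> p0; apply/eqP; apply: contraT => np0.
pose s := [seq (M0 + j%:Z)%:~R : R | j <- iota 0 (size p)].
have := max_poly_roots np0 (rs := s); rewrite size_map size_iota ltnn.
apply.
  by apply/allP => _ /mapP[j _ ->]; apply/rootP/p0; rewrite lerDl.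
rewrite map_inj_uniq ?iota_uniq// => i j /intr_inj /addrI; by case.
Qed.

(* Bezout's identity gives a polynomial [pi] in the shift that is the identity
   on constants and maps every [f t] to a function killed by [('X - 1) ^+ d.+1]:
   the periodic parts of the quasi-polynomials [f t] cancel out in a sum that is
   independent of [M]. *)
Lemma constant_sum_polynomial (I : finType) d (f : I -> int -> R)
    (h : I -> seq nat) :
  (forall t, size (h t) <= d)%N -> (forall t, all (leq 1) (h t)) ->
  (forall t, exists M0, forall M, M0 <= M ->
     shift_poly (('X - 1) * \prod_(k <- h t) ('X^k - 1)) (f t) M = 0) ->
  exists p : I -> {poly R}, (forall t, size (p t) <= d.+1)%N /\
    forall (c : R) (s : I -> int) (M1 : int),
      (forall M, M1 <= M -> \sum_t f t (M - s t) = c) ->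
      c = \sum_t (p t).[- (s t)%:~R].
Proof.
move=> sh h0 fE.
(* [E t] is what remains of the product of the ['X^k - 1] after one factor ['X - 1] is taken out of
   each. Its value at 1 is the product of the [k], so it is coprime to ['X - 1]. *)
pose E t : {poly R} := \prod_(k <- h t) \sum_(i < k) 'X^i.
have DE t : \prod_(k <- h t) ('X^k - 1) = ('X - 1) ^+ size (h t) * E t.
  rewrite /E; elim: (h t) => [|k l IHl]; first by rewrite !big_nil mulr1.
  by rewrite !big_cons IHl subrX1 exprS mulrACA.
have E1 t : (E t).[1] != 0.
  rewrite horner_prod prodf_seq_neq0; apply/allP => k kh /=.
  rewrite horner_sum (eq_bigr (fun=> 1)); last first.
    by move=> i _; rewrite hornerXn expr1n.
  by rewrite sumr_const card_ord pnatr_eq0 -lt0n (allP (h0 t)).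
have : coprimep (\prod_t E t) (('X - 1) ^+ d.+1).
  rewrite coprimep_expr// coprimep_XsubC /root horner_prod.
  by apply/prodf_neq0 => t _; apply: E1.
move=> /Bezout_eq1_coprimepP[[u w] /= uw].
pose P := u * \prod_t E t.
have P1 : P.[1] = 1.
  rewrite -[RHS](hornerC 1 1) polyC1 -uw hornerD [X in _ = _ + X]hornerM.
  by rewrite horner_exp hornerXsubC subrr expr0n /= mulr0 addr0.
(* [P] contains [E t], and [d.+1] exceeds the length of [h t], so the total operator is a multiple
   of the one that kills [f t]. *)
have killed t : exists M0, forall M, M0 <= M ->
    shift_poly (('X - 1) ^+ d.+1) (shift_poly P (f t)) M = 0.
  have [M0 fM0] := fE t; exists M0 => M leM.
  have -> : shift_poly (('X - 1) ^+ d.+1) (shift_poly P (f t)) M =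
      shift_poly (('X - 1) ^+ (d - size (h t)) * u * \prod_(t' | t' != t) E t')
        (shift_poly (('X - 1) * \prod_(k <- h t) ('X^k - 1)) (f t)) M.
    rewrite -!shift_polyM DE /P (bigD1 t)//=; congr (shift_poly _ _ _).
    rewrite -(subnK (sh t)) exprS exprD addnK; ring.
  by apply: shift_poly_eq0 => N leN; apply: fM0; apply: le_trans leN.
have /choice[M0 killedM] := killed.
have /choice[p pE] t := shift_poly_kernel (killedM t).
exists p; split=> [t|c s M1 cE]; first exact: (pE t).1.
(* For [M] beyond [N0], applying [P] to the constant sum shows that [c] is the sum of the [p t] at
   [M - s t]. Hence [q] is zero, and its value at 0 is the claim. *)
pose q := \sum_t (p t \Po ('X - (s t)%:~R%:P)) - c%:P.
have q0 : q = 0.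
  pose N0 := \big[Order.max/M1]_t (M0 t + s t).
  apply: (@poly_eq0_large _ N0) => M leM.
  rewrite hornerD hornerN hornerC horner_sum; apply/eqP; rewrite subr_eq0.
  apply/eqP.
  have := shift_poly_cst P c M; rewrite P1 mul1r => <-.
  rewrite -(@eq_shift_poly _ (fun N => \sum_t f t (N - s t))); last first.
    move=> N leN; apply: cE; apply: le_trans leN; apply: le_trans leM.
    exact: bigmax_ge_id.
  rewrite shift_poly_sum; apply: eq_bigr => t _.
  rewrite horner_comp hornerXsubC -rmorphB /= -(pE t).2//.
  by rewrite lerBrDr (le_trans _ leM)// le_bigmax.
have := congr1 (horner^~ 0) q0; rewrite hornerD hornerN hornerC hornerC.
rewrite horner_sum => /eqP; rewrite subr_eq0 => /eqP <-.
by apply: eq_bigr => t _; rewrite horner_comp hornerXsubC sub0r.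
Qed.

End shift_operators.

(** * Sign patterns and Fourier-Motzkin elimination *)

Section sign_patterns.
Context {R : realFieldType}.

Lemma seq_maximum (x0 : R) s :
  exists2 l, l \in x0 :: s & {in x0 :: s, forall x, x <= l}.
Proof.
elim: s x0 => [|y s IH] x0.
  by exists x0 => [|x]; rewrite mem_seq1// => /eqP ->.
have [l ls lmax] := IH y.
have [xl|/ltW lx] := leP x0 l.
  by exists l => [|x /predU1P[->//|/lmax]//]; rewrite in_cons ls orbT.
exists x0 => [|x /predU1P[->//|/lmax xl]]; first exact: mem_head.
exact: le_trans lx.
Qed.

Lemma separating_point (s t : seq R) :
  {in s & t, forall x y, x < y} ->
  exists z, {in s, forall x, x < z} /\ {in t, forall y, z < y}.
Proof.
have seq_minimum (y0 : R) r :
    exists2 l, l \in y0 :: r & {in y0 :: r, forall y, l <= y}.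
  have [l ls lmax] := seq_maximum (- y0) (map -%R r).
  have oppM x : (- x \in y0 :: r) = (x \in - y0 :: map -%R r).
    by rewrite -[RHS](mem_map (@oppr_inj R)) /= opprK -map_comp (map_id_in) //=
      => ? _; rewrite opprK.
  exists (- l) => [|y yr]; first by rewrite oppM.
  by rewrite lerNl lmax// -oppM opprK.
case: s => [|x0 s]; case: t => [|y0 t] st.
- by exists 0.
- have [l lt lmin] := seq_minimum y0 t; exists (l - 1); split=> // y /lmin ly.
  by rewrite ltrBlDr (le_lt_trans ly)// ltrDl.
- have [l ls lmax] := seq_maximum x0 s; exists (l + 1); split=> // x /lmax xl.
  by rewrite (le_lt_trans xl)// ltrDl.
have [l ls lmax] := seq_maximum x0 s; have [u ut umin] := seq_minimum y0 t.
have lu := st _ _ ls ut; exists ((l + u) / 2); split=> [x /lmax|y /umin]; lra.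
Qed.

Lemma sgr_divr (p q t : R) : q != 0 ->
  Num.sg (p - q * t) = Num.sg q * Num.sg (p / q - t).
Proof. by move=> q0; rewrite -sgrM mulrBr mulrCA divff// mulr1. Qed.

Lemma eq_sgr_lt0 (x y : R) : Num.sg x = Num.sg y -> (x < 0) = (y < 0).
Proof. by move=> xy; rewrite -[LHS]sgr_lt0 xy sgr_lt0. Qed.

Lemma eq_sgr_le0 (x y : R) : Num.sg x = Num.sg y -> (x <= 0) = (y <= 0).
Proof. by move=> xy; rewrite -[LHS]sgr_le0 xy sgr_le0. Qed.

Lemma eq_sgr_gt0 (x y : R) : Num.sg x = Num.sg y -> (0 < x) = (0 < y).
Proof. by move=> xy; rewrite -[LHS]sgr_gt0 xy sgr_gt0. Qed.

Lemma eq_sgr_ge0 (x y : R) : Num.sg x = Num.sg y -> (0 <= x) = (0 <= y).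
Proof. by move=> xy; rewrite -[LHS]sgr_ge0 xy sgr_ge0. Qed.

Lemma eq_sgr_eq0 (x y : R) : Num.sg x = Num.sg y -> (x == 0) = (y == 0).
Proof. by move=> xy; rewrite -[LHS]sgr_eq0 xy sgr_eq0. Qed.

(* Transfer of a point [t] on a line with marks [p u / q u] to a line whose
   marks [p' u / q u] are in the same order. *)
Lemma sign_pattern_line (T : eqType) (L : seq T) (p p' q : T -> R) :
  {in L, forall u, Num.sg (p u) = Num.sg (p' u)} ->
  {in L & L, forall u v,
     Num.sg (p u * q v - p v * q u) = Num.sg (p' u * q v - p' v * q u)} ->
  forall t, exists t', {in L, forall u,
     Num.sg (p u - q u * t) = Num.sg (p' u - q u * t')}.
Proof.
move=> sp spq t.
suff [t' t'E] : exists t', {in L, forall u, q u != 0 ->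
    Num.sg (p u / q u - t) = Num.sg (p' u / q u - t')}.
  exists t' => u uL; have [->|qu0] := eqVneq (q u) 0.
    by rewrite !mul0r !subr0 sp.
  by rewrite !sgr_divr// t'E.
have ratioE u v : u \in L -> v \in L -> q u != 0 -> q v != 0 ->
    Num.sg (p u / q u - p v / q v) = Num.sg (p' u / q u - p' v / q v).
  move=> uL vL qu qv.
  have E (r : T -> R) : r u / q u - r v / q v =
      (r u * q v - r v * q u) * (q u)^-1 * (q v)^-1 by field; apply/andP.
  by rewrite !E !sgrM spq.
(* If [t] is itself a mark, [t'] is the corresponding mark; otherwise [t'] separates the images of
   the marks below [t] from those of the marks above. *)
have [/hasP[u uL /andP[qu0 /eqP tE]]|/hasPn nt] :=
    boolP (has (fun u => (q u != 0) && (t == p u / q u)) L).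
  by exists (p' u / q u) => v vL qv0; rewrite tE ratioE.
pose below := [seq p' u / q u | u <- L & (q u != 0) && (p u / q u < t)].
pose above := [seq p' u / q u | u <- L & (q u != 0) && (t < p u / q u)].
have [|t' [bt' at']] := @separating_point below above.
  move=> _ _ /mapP[u + ->] /mapP[v + ->].
  rewrite !mem_filter => /andP[/andP[qu ut] uL] /andP[/andP[qv tv] vL].
  rewrite -subr_lt0 -(eq_sgr_lt0 (ratioE u v uL vL qu qv)) subr_lt0.
  exact: lt_trans tv.
exists t' => u uL qu0; have := nt u uL; rewrite qu0 /= => tu.
have [ut|tu'] : p u / q u < t \/ t < p u / q u.
  by apply/orP; rewrite -neq_lt eq_sym.
  rewrite !ltr0_sg ?subr_lt0// bt'//; apply: (map_f (fun u => p' u / q u)).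
  by rewrite mem_filter qu0 ut.
rewrite !gtr0_sg ?subr_gt0// at'//; apply: (map_f (fun u => p' u / q u)).
by rewrite mem_filter qu0 tu'.
Qed.

End sign_patterns.

(** Induction on the columns. For a fixed first coordinate [t], the forms [u] obtained for the other
    columns are affine in [t]. The added combinations of [u] and [v] annihilate the first column,
    and their signs give the order of the zeros of these affine functions. *)
Lemma sign_pattern_elimination (R : realType) (m n : nat) (A : 'M[rat]_(m, n)) :
  exists L : seq 'rV[rat]_m, forall beta beta' : 'cV[R]_m,
    {in L, forall u, Num.sg ((map_mx ratr u *m beta) 0 0) =
                     Num.sg ((map_mx ratr u *m beta') 0 0)} ->
    forall x : 'cV[R]_n, exists x' : 'cV[R]_n, forall i,
      Num.sg ((beta - map_mx ratr A *m x) i 0) =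
      Num.sg ((beta' - map_mx ratr A *m x') i 0).
Proof.
elim: n A => [|n IH] A.
  exists [seq delta_mx 0 i | i <- enum 'I_m] => beta beta' bb' x; exists x => i.
  have dE (z : 'cV[R]_m) : (map_mx ratr (delta_mx 0 i :
    'rV[rat]_m) *m z) 0 0 = z i 0.
    by rewrite map_delta_mx -rowE mxE.
  rewrite (_ : x = 0) ?mulmx0 ?subr0; last by apply/matrixP => -[].
  by rewrite -!dE; apply: bb'; apply: map_f; rewrite mem_enum.
rewrite -[n.+1]/(1 + n)%N in A *.
have [L LE] := IH (rsubmx A); pose a := lsubmx A.
exists (L ++ [seq (v *m a) 0 0 *: u - (u *m a) 0 0 *: v | u <- L, v <- L]).
move=> beta beta' bb' x.
pose ev (z : 'cV[R]_m) (u : 'rV[rat]_m) := (map_mx ratr u *m z) 0 0.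
pose q (u : 'rV[rat]_m) : R := ratr ((u *m a) 0 0).
have evB z u v (c d : rat) : ev z (c *: u - d *: v) =
  ratr c * ev z u - ratr d * ev z v.
  by rewrite /ev map_mxB !map_mxZ mulmxBl -!scalemxAl !mxE.
have [u uL|u v uL vL|t' t'E] :=
  @sign_pattern_line R _ L (ev beta) (ev beta') q _ _ (x 0 0).
- by apply: bb'; rewrite mem_cat uL.
- have := bb' ((v *m a) 0 0 *: u - (u *m a) 0 0 *: v).
  rewrite -!/(ev _ _) !evB -!/(q _) ![q _ * _]mulrC; apply.
  by rewrite mem_cat; apply/orP; right; apply/allpairsP; exists (u, v).
have evE z (t : R) u : ev (z - map_mx ratr a *m t%:M) u = ev z u - q u * t.
  rewrite /ev mulmxBr mulmxA -map_mxM /= mul_mx_scalar [LHS]mxE [X in _ + X]mxE.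
  by rewrite [X in _ - X]mxE [X in _ - _ * X]mxE mulrC.
pose x1 : 'cV[R]_n := dsubmx x.
have [u uL|x' x'E] := LE (beta - map_mx ratr a *m (x 0 0)%:M)
                      (beta' - map_mx ratr a *m t'%:M) _ x1.
  by rewrite -!/(ev _ _) !evE t'E.
have AE (z : 'cV[R]_m) (t : 'cV[R]_1) w : z - map_mx ratr A *m col_mx t w =
    z - map_mx ratr a *m t - map_mx ratr (rsubmx A) *m w.
  by rewrite -{1}(hsubmxK A) map_row_mx mul_row_col opprD addrA.
exists (col_mx t'%:M x') => i; rewrite AE -x'E.
rewrite -[x in LHS]vsubmxK AE; congr (Num.sg ((_ - _ *m _ - _) i 0)).
by apply/matrixP => j k; rewrite !ord1 !mxE eqxx mulr1n; congr (x _ _);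
  apply/val_inj.
Qed.

(** * Cells of a hyperplane arrangement *)

Lemma affine_form_continuous (R : realType) (N n : nat) (C : 'M[R]_(N, n))
    (d : 'cV[R]_N) k : continuous (fun y : 'cV[R]_n => (C *m y + d) k 0).
Proof.
have sumE s : continuous (fun y : 'cV[R]_n => \sum_(j <- s) C k j * y j 0).
  elim: s => [|j s IH].
    have -> : (fun y : 'cV[R]_n => \sum_(j <- [::]) C k j * y j 0) = cst 0.
      by apply/funext => z; rewrite big_nil.
    exact: cst_continuous.
  have -> : (fun y : 'cV[R]_n => \sum_(i <- j :: s) C k i * y i 0) =
    (fun z : 'cV[R]_n => C k j * z j 0 + \sum_(i <- s) C k i * z i 0).
    by apply/funext => z; rewrite big_cons.
  have coordE : continuous (fun z : 'cV[R]_n => C k j * z j 0).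
    move=> y; apply: (@continuous_comp _ _ _ (fun z : 'cV[R]_n => z j 0)).
      exact: coord_continuous.
    exact: mulrl_continuous.
  by move=> y; exact: (cvgD (coordE y) (IH y)).
have -> : (fun y : 'cV[R]_n => (C *m y + d) k 0) =
    (fun z => \sum_(j <- index_enum 'I_n) C k j * z j 0 + d k 0).
  by apply/funext => z; rewrite !mxE.
by move=> y; exact: (cvgD (sumE _ y) (@cst_continuous _ _ (d k 0) y)).
Qed.

Section cells.
Context {R : realType} {N n : nat}.
Variables (C : 'M[rat]_(N, n)) (d : 'cV[rat]_N).

Definition forms (y : 'cV[R]_n) : 'cV[R]_N :=
  map_mx ratr C *m y + map_mx ratr d.

Definition sign_class (y0 : 'cV[R]_n) : set 'cV[R]_n :=
  [set y | forall k, Num.sg (forms y k 0) = Num.sg (forms y0 k 0)].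

(** The two implications treat the three signs at once: a form that vanishes at [y0] has to vanish
    on the whole cell. *)
Definition closed_cell (y0 : 'cV[R]_n) : set 'cV[R]_n :=
  [set y | forall k, (forms y0 k 0 <= 0 -> forms y k 0 <= 0) /\
                     (0 <= forms y0 k 0 -> 0 <= forms y k 0)].

Lemma forms_combination (y z : 'cV[R]_n) s k :
  forms (y + s *: (z - y)) k 0 = forms y k 0 + s * (forms z k 0 - forms y k 0).
Proof. by rewrite /forms mulmxDr -scalemxAr mulmxBr !mxE; ring. Qed.

Lemma sign_class_sym y z : sign_class y z -> sign_class z y.
Proof. by move=> yz k; rewrite yz. Qed.

Lemma sign_class_trans y z w : sign_class y z -> sign_class z w ->
  sign_class y w.
Proof. by move=> yz zw k; rewrite zw yz. Qed.

Lemma sign_class_cell y0 : sign_class y0 `<=` closed_cell y0.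
Proof. by move=> y yE k; rewrite (eq_sgr_le0 (yE k)) (eq_sgr_ge0 (yE k)). Qed.

Lemma closed_cell_eq y z : sign_class y z -> closed_cell y = closed_cell z.
Proof.
move=> yz; apply/seteqP; split=> w wE k; have := wE k;
  by rewrite (eq_sgr_le0 (yz k)) (eq_sgr_ge0 (yz k)).
Qed.

Lemma closed_cell_segment y0 y z s : closed_cell y0 y -> sign_class y0 z ->
  0 < s -> s <= 1 -> sign_class y0 (y + s *: (z - y)).
Proof.
move=> yQ z0 s0 s1 k; rewrite -(z0 k) forms_combination.
have {yQ}[] := yQ k; rewrite -(eq_sgr_le0 (z0 k)) -(eq_sgr_ge0 (z0 k)).
have -> : forms y k 0 + s * (forms z k 0 - forms y k 0) =
  (1 - s) * forms y k 0 + s * forms z k 0 by ring.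
have s1' : 0 <= 1 - s by rewrite subr_ge0.
case: (ltrgt0P (forms z k 0)) => [z1 _ y1|z1 y1 _|-> y1 y2].
- by rewrite !gtr0_sg// ltr_wpDl ?mulr_gt0 ?mulr_ge0 ?y1.
- rewrite !ltr0_sg// -oppr_gt0 opprD -!mulrN ltr_wpDl ?mulr_gt0 ?oppr_gt0//.
  by rewrite mulr_ge0// oppr_ge0 y1.
- by rewrite (le_anti (introT andP (conj (y1 _) (y2 _)))) ?mulr0 ?addr0.
Qed.

(** A form that is nonzero at [y0] but zero at [y] would take the wrong sign just beyond [y]. *)
Lemma closed_cell_extrapolate y0 y : closed_cell y0 y ->
  (exists2 e : R, 0 < e & closed_cell y0 (y + e *: (y - y0))) ->
  sign_class y0 y.
Proof.
move=> yQ [e e0 eQ] k; have [y1 y2] := yQ k; have := eQ k.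
have -> : y + e *: (y - y0) = y + (- e) *: (y0 - y).
  by rewrite scaleNr -scalerN opprB.
rewrite forms_combination mulNr.
case: (ltrgt0P (forms y0 k 0)) y1 y2 => [z1 _ y1|z1 y1 _|-> y1 y2].
- move=> [_ /(_ isT) ye]; rewrite !gtr0_sg//.
  rewrite lt_neqAle y1// andbT eq_sym; apply: contraTneq ye => ->.
  by rewrite subr0 add0r -ltNge oppr_lt0 mulr_gt0.
- move=> [/(_ isT) ye _]; rewrite !ltr0_sg//.
  rewrite lt_neqAle y1// andbT; apply: contraTneq ye => ->.
  by rewrite subr0 add0r -ltNge oppr_gt0 pmulr_rlt0.
- by rewrite (le_anti (introT andP (conj (y1 _) (y2 _)))).
Qed.

(** A point of the relative interior can be pushed slightly away from [y0] inside the cell.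
    Conversely, the forms that are nonzero at [y0] keep their signs near [y], and the other ones
    vanish on the affine hull. *)
Lemma relint_closed_cell y0 : relint (closed_cell y0) = sign_class y0.
Proof.
have y00 : closed_cell y0 y0 by apply: sign_class_cell.
apply/seteqP; split=> y.
  move=> [yQ /nbhs_ballP[e /= e0 yeQ]]; apply: closed_cell_extrapolate => //.
  (* With this factor the displacement [e' *: (y - y0)] has norm less than [e], also if [y = y0]. *)
  pose e' := e / 2 / (1 + `|y - y0|).
  have e'0 : 0 < e' by rewrite !divr_gt0// ltr_pwDl.
  exists e' => //; apply: yeQ.
    rewrite -ball_normE /ball_ /= opprD addNKr normrN normrZ (gtr0_norm e'0).
    rewrite /e' mulrAC ltr_pdivrMr ?ltr_pwDl// mulrDr mulr1 mulrC.
    have := normr_ge0 (y - y0); nra.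
  exists 2, (fun i => if i == 0 then 1 + e' else - e'),
    (fun i => if i == 0 then y else y0); split.
  - by move=> i; case: ifP.
  - by rewrite !big_ord_recl big_ord0 /=; ring.
  - rewrite !big_ord_recl big_ord0 /= addr0 scalerDl scale1r scalerBr scaleNr.
    by rewrite addrA.
move=> yE; split; first exact: sign_class_cell.
pose good k : set 'cV[R]_n := [set x | affine_hull (closed_cell y0) x ->
    (forms y0 k 0 <= 0 -> forms x k 0 <= 0) /\
    (0 <= forms y0 k 0 -> 0 <= forms x k 0)].
suff gE k : nbhs y (good k).
  rewrite /within /=; apply: filterS (filter_forall _ gE) => x xE xQ k.
  exact: (xE k).
have := yE k.
have cE := @affine_form_continuous R N n (map_mx ratr C) (map_mx ratr d) k y.
case: (ltrgt0P (forms y0 k 0)) => y0k.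
- rewrite (gtr0_sg y0k) => /eqP; rewrite sgr_cp0 => yk.
  have H : nbhs y [set x | 0 < forms x k 0] by exact: (cvgr_gt _ cE _ yk).
  by apply: filterS H => x xk _; split=> [|_]; [rewrite leNgt y0k|exact: ltW].
- rewrite (ltr0_sg y0k) => /eqP; rewrite sgr_cp0 => yk.
  have H : nbhs y [set x | forms x k 0 < 0] by exact: (cvgr_lt _ cE _ yk).
  by apply: filterS H => x xk _; split=> [_|]; [exact: ltW|rewrite leNgt y0k].
- move=> _; have H : nbhs y setT by exact: filterT.
  apply: filterS H => x _ [j [w [p [pQ w1 ->]]]].
  suff -> : forms (\sum_i w i *: p i) k 0 = 0 by [].
  have pk i : forms (p i) k 0 = 0.
    have [p1 p2] := pQ i k; apply/eqP; rewrite eq_le p1 ?p2 ?y0k//.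
  have -> : forms (\sum_i w i *: p i) = \sum_i w i *: forms (p i).
    rewrite /forms mulmx_sumr [map_mx ratr d in LHS](_ : _ =
      \sum_i w i *: map_mx ratr d).
      rewrite -big_split; apply: eq_bigr => i _.
      by rewrite /= -scalemxAr scalerDr.
    by rewrite -scaler_suml w1 scale1r.
  by rewrite summxE big1// => i _; rewrite mxE pk mulr0.
Qed.

Lemma rational_polyhedron_closed_cell y0 : rational_polyhedron (closed_cell y0).
Proof.
(* The factors [s1] and [s2] turn an inequality that is not imposed into [0 <= 0]. *)
pose s1 k : rat := (forms y0 k 0 <= 0)%R%:R; pose s2 k : rat :=
  (0 <= forms y0 k 0)%R%:R.
pose D1 := \matrix_(k, j) (s1 k * C k j); pose D2 :=
  \matrix_(k, j) (- s2 k * C k j).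
exists (N + N)%N, (col_mx D1 D2),
  (col_mx (\col_k (- s1 k * d k 0)) (\col_k (s2 k * d k 0))).
have E1 y k : (map_mx ratr D1 *m y : 'cV[R]_N) k 0 =
  ratr (s1 k) * (map_mx ratr C *m y) k 0.
  rewrite !mxE mulr_sumr; apply: eq_bigr => j _; rewrite !mxE rmorphM /=; ring.
have E2 y k : (map_mx ratr D2 *m y : 'cV[R]_N) k 0 =
  - ratr (s2 k) * (map_mx ratr C *m y) k 0.
  rewrite !mxE mulr_sumr; apply: eq_bigr => j _;
    rewrite !mxE rmorphM rmorphN /=; ring.
have fE y k : forms y k 0 = (map_mx ratr C *m y) k 0 + ratr (d k 0).
  by rewrite [LHS]mxE [X in _ + X]mxE.
apply/seteqP; split=> y /= yE.
  move=> i; rewrite map_col_mx mul_col_mx; case: (split_ordP i) => k ->.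
    rewrite !col_mxEu E1 mxE rmorphM rmorphN /=; have := (yE k).1.
    rewrite (fE y) /s1; case: (_ <= 0) => [/(_ isT)|_];
      rewrite ?rmorph0 ?rmorph1; lra.
  rewrite !col_mxEd E2 mxE rmorphM /=; have := (yE k).2.
  rewrite (fE y) /s2; case: (0 <= _) => [/(_ isT)|_];
    rewrite ?rmorph0 ?rmorph1; lra.
move=> k; split=> yk.
  have := yE (lshift N k); rewrite map_col_mx mul_col_mx !col_mxEu E1 mxE.
  rewrite rmorphM rmorphN /= (fE y) /s1 yk rmorph1; lra.
have := yE (rshift N k); rewrite map_col_mx mul_col_mx !col_mxEd E2 mxE.
rewrite rmorphM /= (fE y) /s2 yk rmorph1; lra.
Qed.

Lemma finite_closed_cells (X : set 'cV[R]_n) : finite_set (closed_cell @` X).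
Proof.
pose cell (s : {ffun 'I_N -> bool * bool}) : set 'cV[R]_n :=
  [set y | forall k, ((s k).1 -> forms y k 0 <= 0) /\ ((s k).2 ->
    0 <= forms y k 0)].
apply: (@sub_finite_set _ _ (cell @` setT));
  last exact/finite_image/finite_finset.
move=> _ [y _ <-]; exists [ffun k => (forms y k 0 <= 0, 0 <= forms y k 0)] =>
  //.
by apply/seteqP; split=> z zE k; have := zE k; rewrite ffunE.
Qed.

End cells.

(** * Faces and vertices of polyhedra *)

Lemma kernel_vector (F : fieldType) (m n : nat) (A : 'M[F]_(m, n))
    (K : {set 'I_m}) : (#|K| < n)%N ->
  exists2 w : 'cV[F]_n, w != 0 & forall i, i \in K -> (A *m w) i 0 = 0.
Proof.
move=> ltKn; pose M := rowsub (enum_val : 'I_#|K| -> 'I_m) A.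
have /matrix0Pn[i [j Cij]] : cokermx M != 0.
  rewrite -mxrank_eq0 mxrank_coker subn_eq0 -ltnNge.
  exact: leq_ltn_trans (rank_leq_row M) ltKn.
have Mw : M *m col j (cokermx M) = 0 by rewrite colE mulmxA mulmx_coker mul0mx.
exists (col j (cokermx M)) => [|k kK].
  by apply: contraNneq Cij => /matrixP/(_ i 0); rewrite !mxE => ->.
have /matrixP/(_ (enum_rank_in kK k) 0) := Mw.
by rewrite /M mul_rowsub_mx [LHS]mxE [RHS]mxE enum_rankK_in.
Qed.

Section polyhedra.
Context {R : realType} {m n : nat}.
Variable A : 'M[R]_(m, n).
Implicit Types (beta : 'cV[R]_m) (x w : 'cV[R]_n) (K : {set 'I_m}).

Definition slack beta x i : R := (beta - A *m x) i 0.

Definition polyhedron beta : set 'cV[R]_n := [set x | forall i,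
  0 <= slack beta x i].

Definition face_of beta K : set 'cV[R]_n :=
  [set x | polyhedron beta x /\ forall i, i \in K -> slack beta x i = 0].

Definition active beta (F : set 'cV[R]_n) : {set 'I_m} :=
  [set i | `[< forall x, F x -> slack beta x i = 0 >]]%SET.

Lemma activeP beta F i : reflect (forall x, F x -> slack beta x i =
  0) (i \in active beta F).
Proof. by rewrite finset.inE; exact: asboolP. Qed.

Lemma slackD beta x w s i : slack beta (x + s *: w) i =
  slack beta x i - s * (A *m w) i 0.
Proof. by rewrite /slack mulmxDr -scalemxAr !mxE; ring. Qed.

Lemma slack_diff beta x z i : (A *m (z - x)) i 0 =
  slack beta x i - slack beta z i.
Proof. by rewrite /slack mulmxBr !mxE; ring. Qed.

Lemma slack_combination beta x z s i :
  slack beta (x + s *: (z - x)) i =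
    (1 - s) * slack beta x i + s * slack beta z i.
Proof. by rewrite slackD (slack_diff beta); ring. Qed.

Lemma small_step beta x w : polyhedron beta x ->
  (forall i, slack beta x i = 0 -> (A *m w) i 0 = 0) ->
  exists2 e : R, 0 < e & polyhedron beta (x + e *: w).
Proof.
(* [c i] is a step length that keeps constraint [i] satisfied. A tight constraint is constant along
   [w] and gets the default 1. *)
move=> xP wE; pose c i := if slack beta x i == 0 then 1
  else slack beta x i / (1 + `|(A *m w) i 0|).
have d0 i : 0 < 1 + `|(A *m w) i 0| by rewrite ltr_pwDl.
exists (\big[Num.min/1]_i c i).
  rewrite lt_bigmin// => i _; rewrite /c; case: eqVneq => // sx.
  by rewrite divr_gt0// lt_neqAle eq_sym sx xP.
move=> i; rewrite slackD; have [sx|sx] := eqVneq (slack beta x i) 0.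
  by rewrite sx wE// mulr0 subr0.
set e := \big[_/_]_i _; have e0 : 0 < e.
  rewrite lt_bigmin// => j _; rewrite /c; case: eqVneq => // sj.
  by rewrite divr_gt0// lt_neqAle eq_sym sj xP.
have : e <= c i by exact: bigmin_le.
rewrite /c (negbTE sx) ler_pdivlMr// => ec.
have := ler_norm (e * (A *m w) i 0); rewrite normrM (gtr0_norm e0); lra.
Qed.

(** The sum of the constraints in [K] supports the face: a sum of nonnegative slacks vanishes only
    if each of them does. *)
Lemma face_of_face beta K : face (polyhedron beta) (face_of beta K).
Proof.
pose u : 'rV[R]_m := \row_i (i \in K)%:R.
have E x : (u *m beta) 0 0 - (u *m A *m x) 0 0 = \sum_(i in K) slack beta x i.
  transitivity ((u *m (beta - A *m x)) 0 0).
    by rewrite mulmxBr mulmxA [in RHS]mxE [X in _ = _ + X]mxE.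
  rewrite mxE [RHS]big_mkcond; apply: eq_bigr => i _ /=; rewrite mxE.
  by case: ifP; rewrite ?mul1r ?mul0r.
exists (u *m A), ((u *m beta) 0 0); split=> [x xP|].
  by rewrite -subr_ge0 E sumr_ge0.
apply/seteqP; split=> x [xP xK]; split=> //.
  by apply/esym/eqP; rewrite -subr_eq0 E big1.
have /eqP := E x; rewrite xK subrr eq_sym psumr_eq0// => /allP sK i iK.
by have /implyP/(_ iK)/eqP := sK i (mem_index_enum i).
Qed.

Lemma face_sub beta F : face (polyhedron beta) F -> F `<=` polyhedron beta.
Proof. by move=> [u [t [_ ->]]] x []. Qed.

(** The midpoint of two points of [F] is tight only where both are; averaging once for each inactive
    constraint makes all of these strict. *)
Lemma face_relint beta F : face (polyhedron beta) F -> F !=set0 ->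
  exists2 x, F x & forall i, slack beta x i = 0 -> i \in active beta F.
Proof.
move=> faceF [x0 Fx0].
suff [x Fx xE] : exists2 x, F x & {in enum 'I_m, forall i, slack beta x i =
  0 -> i \in active beta F}.
  by exists x => // i; apply: xE; rewrite mem_enum.
elim: (enum _) => [|i s [x Fx xE]]; first by exists x0.
have [iF|niF] := boolP (i \in active beta F).
  by exists x => // j; rewrite in_cons => /predU1P[->//|/xE].
have [z Fz zi] : exists2 z, F z & slack beta z i != 0.
  apply: contrapT => nz; case/negP: niF; apply/activeP => z Fz.
  by apply/eqP; apply: contrapT => /negP zi; apply: nz; exists z.
have [xP zP] := (face_sub faceF Fx, face_sub faceF Fz).
have avgE j : slack beta (x + 2^-1 *: (z - x)) j =
  2^-1 * slack beta x j + 2^-1 * slack beta z j.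
  by rewrite slack_combination; field.
exists (x + 2^-1 *: (z - x)).
  have [u [t [ut FE]]] := faceF; rewrite FE in Fx Fz *; split.
    by move=> j; rewrite avgE addr_ge0// mulr_ge0// ?invr_ge0.
  case: Fx => _ xt; case: Fz => _ zt; rewrite mulmxDr -scalemxAr mulmxBr.
  rewrite [LHS]mxE [X in _ + X]mxE [X in _ * X]mxE [X in _ * (_ + X)]mxE xt zt.
  by rewrite subrr mulr0 addr0.
move=> j; rewrite in_cons avgE => + /eqP.
rewrite paddr_eq0 ?mulr_ge0 ?invr_ge0 ?xP ?zP//.
rewrite !mulf_eq0 invr_eq0 (negbTE (lt0r_neq0 _)) ?ltr0n//= => jE /andP[xj zj].
by case/predU1P: jE => [jE|/xE]; [rewrite -jE zj in zi|apply; apply/eqP].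
Qed.

(** If [z] is tight on the active constraints, the segment from [z] to a relative interior point [x]
    of [F] can be prolonged beyond [x]. A functional that is maximal at [x] is then maximal at [z]
    as well. *)
Lemma face_active beta F : face (polyhedron beta) F -> F !=set0 ->
  F = face_of beta (active beta F).
Proof.
move=> faceF F0; have [x Fx xE] := face_relint faceF F0.
have FP := face_sub faceF.
apply/seteqP; split=> [z Fz|z [zP zE]].
  by split=> [|i /activeP]; [exact: FP|exact].
have [i /xE iF|e e0 eP] := @small_step beta x (x - z) (FP _ Fx).
  by rewrite (slack_diff beta) zE// (activeP _ _ _ iF)// subrr.
have [u [t [ut FE]]] := faceF; rewrite FE in Fx *; split=> //.
case: Fx => _ xt; apply: le_anti; rewrite ut//=.
have := ut _ eP; rewrite mulmxDr -scalemxAr mulmxBr.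
rewrite [X in X <= _]mxE [X in _ + X]mxE [X in _ * X]mxE [X in _ * (_ + X)]mxE
  xt.
by rewrite gerDl pmulr_rle0// subr_le0.
Qed.

(* The empty face is treated separately because it has the same active
   constraints as a vertex on all the hyperplanes. *)
Definition transfer beta beta' (F : set 'cV[R]_n) : set 'cV[R]_n :=
  [set x | F !=set0 /\ face_of beta' (active beta F) x].

Definition sign_pattern_sub beta beta' : Prop :=
  forall x, exists x', forall i, Num.sg (slack beta x i) =
    Num.sg (slack beta' x' i).

Lemma face0 (S : set 'cV[R]_n) : face S set0.
Proof.
exists 0, 1; split=> [x _|]; first by rewrite mul0mx mxE ler01.
by apply/seteqP; split=> // x [_]; rewrite mul0mx mxE => /esym/eqP;
  rewrite oner_eq0.
Qed.

Lemma transfer_set0 beta beta' : transfer beta beta' set0 = set0.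
Proof. by apply/seteqP; split=> // x [[]]. Qed.

Lemma transferE beta beta' F : F !=set0 ->
  transfer beta beta' F = face_of beta' (active beta F).
Proof. by move=> F0; apply/seteqP; split=> [x []//|x]. Qed.

Lemma transfer_face beta beta' F :
  face (polyhedron beta') (transfer beta beta' F).
Proof.
have [F0|nF0] := pselect (F !=set0).
  by rewrite transferE//; exact: face_of_face.
by rewrite (_ : transfer _ _ _ = set0)//; [exact: face0|apply/seteqP;
  split=> // x [/nF0]].
Qed.

(** A point with the signs of a relative interior point of [F] lies in the transferred face and is
    tight there on the active constraints of [F] only. *)
Lemma transfer_active beta beta' F : sign_pattern_sub beta beta' ->
  face (polyhedron beta) F -> F !=set0 ->
  transfer beta beta' F !=set0 /\ active beta' (transfer beta beta' F) =
    active beta F.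
Proof.
move=> bb' faceF F0; have [x Fx xE] := face_relint faceF F0.
have [x' x'E] := bb' x.
have Fx' : transfer beta beta' F x'.
  split=> //; split=> i.
    by rewrite -(eq_sgr_ge0 (x'E i)); apply: (face_sub faceF).
  move=> /activeP/(_ _ Fx) xi; apply/eqP.
  by rewrite -(eq_sgr_eq0 (x'E i)) xi.
split; first by exists x'.
apply/setP => i; apply/activeP/idP => [|iF z [_ [_ /(_ _ iF)//]]].
by move=> /(_ _ Fx')/eqP; rewrite -(eq_sgr_eq0 (x'E i)) => /eqP/xE.
Qed.

Lemma transferK beta beta' F : sign_pattern_sub beta beta' ->
  face (polyhedron beta) F -> transfer beta' beta (transfer beta beta' F) = F.
Proof.
move=> bb' faceF; have [F0|/set0P/negP/negPn/eqP ->] := pselect (F !=set0).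
  have [F0' E] := transfer_active bb' faceF F0.
  by rewrite transferE// E -face_active.
by rewrite !transfer_set0.
Qed.

Lemma transfer_sub beta beta' F G : F `<=` G ->
  transfer beta beta' F `<=` transfer beta beta' G.
Proof.
move=> FG x [[z Fz] [xP xE]]; split; first by exists z; apply: FG.
by split=> // i /activeP iG; apply: xE; apply/activeP => w /FG; apply: iG.
Qed.

Lemma sign_pattern_combinatorial_type beta beta' :
  sign_pattern_sub beta beta' -> sign_pattern_sub beta' beta ->
  same_combinatorial_type (polyhedron beta) (polyhedron beta').
Proof.
move=> bb' b'b; exists (transfer beta beta'); split.
  split=> [F _|F G /set_mem FF /set_mem FG FGE|F faceF].
  - exact: transfer_face.
  - by rewrite -(transferK bb' FF) FGE transferK.
  - by exists (transfer beta' beta F); [exact: transfer_face|exact: transferK].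
move=> F G FF FG; split; first exact: transfer_sub.
by move/(@transfer_sub beta' beta); rewrite !transferK.
Qed.

(** * Bases and vertices *)

Definition base_point (I : base A) beta : 'cV[R]_n :=
  invmx (rowsub (rows_of I) A) *m rowsub (rows_of I) beta.

Lemma rows_ofP (I : base A) i : reflect (exists k, i =
  rows_of I k) (i \in base_set I).
Proof.
apply: (iffP idP) => [iI|[k ->]]; last exact: enum_valP.
exists (cast_ord (base_card I) (enum_rank_in iI i)).
by rewrite /rows_of /base_row cast_ordK enum_rankK_in.
Qed.

Lemma base_pointP (I : base A) beta x :
  (forall i, i \in base_set I -> slack beta x i = 0) <-> x = base_point I beta.
Proof.
have E : rowsub (rows_of I) A *m base_point I beta = rowsub (rows_of I) beta.
  by rewrite /base_point mulKVmx//; exact: base_unit.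
split=> [xE|-> i /rows_ofP[k ->]].
  apply: (can_inj (mulKmx (base_unit I))); rewrite E mul_rowsub_mx.
  apply/matrixP => k j; rewrite ord1 [LHS]mxE [RHS]mxE; apply/esym/eqP.
  rewrite -subr_eq0; have /eqP : slack beta x (rows_of I k) = 0.
    by apply: xE; apply/rows_ofP; exists k.
  by rewrite /slack [X in X == _]mxE [X in _ + X == _]mxE.
have Ek := congr1 (fun v : 'cV[R]_n => v k 0) E.
rewrite /= mul_rowsub_mx mxE [RHS]mxE in Ek.
by rewrite /slack [LHS]mxE [X in _ + X]mxE Ek subrr.
Qed.

Lemma slack_base_point (I : base A) beta i :
  i \in base_set I -> slack beta (base_point I beta) i = 0.
Proof. by move: i; apply/base_pointP. Qed.

(** A point with the sign pattern of the base point is tight on the rows of [I], which determine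
    it. *)
Lemma sign_pattern_base_point (I : base A) beta beta' i :
  sign_pattern_sub beta beta' ->
  Num.sg (slack beta (base_point I beta) i) =
    Num.sg (slack beta' (base_point I beta') i).
Proof.
move=> /(_ (base_point I beta))[x' x'E]; rewrite x'E.
suff /base_pointP -> : forall j, j \in base_set I -> slack beta' x' j = 0 by [].
by move=> j jI; apply/eqP; rewrite -(eq_sgr_eq0 (x'E j)) slack_base_point.
Qed.

Definition indep_rows K : Prop :=
  forall u : 'rV[R]_m, (forall i, i \notin K -> u 0 i = 0) -> u *m A = 0 ->
    u = 0.

Lemma indep_rows0 : indep_rows finset.set0.
Proof.
move=> u u0 _; apply/matrixP => j i; rewrite ord1 mxE u0//.
by rewrite finset.inE.
Qed.

(** Applied to [w], a linear relation among the rows leaves only the term of row [k], whose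
    coefficient is therefore zero. *)
Lemma indep_rowsU1 K k w : indep_rows K ->
  (forall i, i \in K -> (A *m w) i 0 = 0) -> (A *m w) k 0 != 0 ->
  indep_rows (k |: K)%SET.
Proof.
move=> indK wK wk u uK uA; apply: indK => // i niK.
have [->|nik] := eqVneq i k; last by apply: uK; rewrite !finset.inE negb_or nik.
have : (u *m (A *m w)) 0 0 = 0 by rewrite mulmxA uA mul0mx mxE.
rewrite mxE (bigD1 k)//= big1 => [|j jk]; last first.
  have [jK|njK] := boolP (j \in K); first by rewrite wK ?mulr0.
  by rewrite uK ?mul0r// !finset.inE negb_or jk.
by rewrite addr0 => /eqP; rewrite mulf_eq0 (negbTE wk) orbF => /eqP.
Qed.

Lemma indep_rows_base K : indep_rows K -> #|K| = n ->
  exists I : base A, base_set I = K.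
Proof.
move=> indK cK; suff uK : rowsub (base_row cK) A \in unitmx by exists (Base uK).
rewrite -row_free_unit; apply: inj_row_free => v vA.
have injr : injective (base_row cK) by move=> i j /enum_val_inj/cast_ord_inj.
pose u : 'rV[R]_m := \sum_k v 0 k *: delta_mx 0 (base_row cK k).
have uE k : u 0 (base_row cK k) = v 0 k.
  rewrite /u summxE (bigD1 k)//= big1 => [|j jk];
    rewrite !mxE ?eqxx ?mulr1 ?addr0//=.
  by rewrite (inj_eq injr) eq_sym (negbTE jk) mulr0.
suff u0 : u = 0 by apply/matrixP => i k; rewrite ord1 -uE u0 !mxE.
apply: indK => [i niK|].
  rewrite /u summxE big1// => k _; rewrite !mxE /=.
  by case: eqVneq => [iE|]; rewrite ?mulr0//; rewrite iE enum_valP in niK.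
rewrite -[RHS]vA /u mulmx_suml; apply/matrixP => i j; rewrite ord1 summxE mxE.
by apply: eq_bigr => k _; rewrite -scalemxAl -rowE !mxE.
Qed.

(** Independent tight rows are added one at a time. While there are fewer than [n], some [w] is
    orthogonal to them; another tight row must vary along [w], for otherwise the face [[set v]]
    would contain a segment. *)
Lemma vert_base_set beta v : vert (polyhedron beta) v ->
  exists I : base A, forall i, i \in base_set I -> slack beta v i = 0.
Proof.
move=> facev; have v0 : [set v] !=set0 by exists v.
have vP : polyhedron beta v by apply: (face_sub facev).
have vE := face_active facev v0.
suff ext d K : (d + #|K|)%N = n -> indep_rows K ->
    (forall i, i \in K -> slack beta v i = 0) ->
    exists I : base A, forall i, i \in base_set I -> slack beta v i = 0.
  apply: (ext n finset.set0); rewrite ?cards0 ?addn0//;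
    first exact: indep_rows0.
  by move=> i; rewrite finset.inE.
elim: d K => [|d IHd] K dK indK KE.
  by have [I IE] := indep_rows_base indK dK; exists I => i; rewrite IE;
    exact: KE.
have [|w w0 wK] := @kernel_vector _ _ _ A K;
  first by rewrite -dK addSn ltnS leq_addl.
have [k vk wk] : exists2 k, slack beta v k = 0 & (A *m w) k 0 != 0.
  apply: contrapT => nk; have [i vi|e e0 eP] := @small_step beta v w vP.
    by apply/eqP; apply: contrapT => /negP wi; apply: nk; exists i.
  have : [set v] (v + e *: w).
    rewrite vE; split=> // i /activeP/(_ v erefl) vi; rewrite slackD vi sub0r.
    suff -> : (A *m w) i 0 = 0 by rewrite mulr0 oppr0.
    by apply/eqP; apply: contrapT => /negP wi; apply: nk; exists i.
  move=> /eqP; rewrite -subr_eq0 addrC addKr scaler_eq0 (gt_eqF e0) /=.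
  exact/negP.
have nkK : k \notin K by apply: contra wk => /wK ->.
apply: (IHd (k |: K)%SET).
- by rewrite cardsU1 nkK add1n addnS -addSn.
- exact: indep_rowsU1 wK wk.
- by move=> i; rewrite !finset.inE => /predU1P[->//|/KE].
Qed.

Lemma base_point_vert (I : base A) beta : polyhedron beta (base_point I beta) ->
  vert (polyhedron beta) (base_point I beta).
Proof.
move=> IP; rewrite /vert /=; have := face_of_face beta (base_set I).
rewrite (_ : face_of _ _ = [set base_point I beta])//.
apply/seteqP; split=> [x [_ /base_pointP]//|_ ->]; split=> //.
exact: slack_base_point.
Qed.

Lemma vert_polyhedron beta : vert (polyhedron beta) =
  [set base_point I beta | I in [set I | polyhedron beta (base_point I beta)]].
Proof.
apply/seteqP; split=> [v vv|_ [I IP <-]]; last exact: base_point_vert.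
have [I /base_pointP IE] := vert_base_set vv; exists I => //.
by rewrite /= -IE; apply: (face_sub vv).
Qed.

End polyhedra.

(** * Generic integral functionals *)

Lemma integral_kernel_vector (m n : nat) (A : 'M[int]_(m, n)) (K : {set 'I_m}) :
  (#|K| < n)%N ->
  exists2 w : 'cV[int]_n, w != 0 & forall i, i \in K -> (A *m w) i 0 = 0.
Proof.
move=> /(kernel_vector (map_mx intr A : 'M[rat]_(m, n)))[w w0 wK].
pose D : int := \prod_j denq (w j 0).
have D0 : D != 0 by apply/prodf_neq0 => j _; exact: denq_neq0.
(* This is [D *: w] over the integers: each numerator times all the other denominators. *)
pose w' : 'cV[int]_n := \col_j (numq (w j 0) * \prod_(k | k != j) denq (w k 0)).
have w'E : map_mx intr w' = D%:~R *: w.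
  apply/matrixP => j k; rewrite ord1 !mxE /= /D [in RHS](bigD1 j)//= !intrM
    numqE.
  ring.
exists w' => [|i iK].
  apply: contra_neq w0 => w'0; apply/eqP; move/eqP: w'E.
  by rewrite w'0 map_mx0 eq_sym scaler_eq0 intr_eq0 (negbTE D0).
apply: (@intr_inj rat); have := wK i iK; rewrite rmorph0 => wi.
transitivity ((map_mx intr A *m map_mx intr w' : 'cV[rat]_m) i 0).
  by rewrite -map_mxM [RHS]mxE.
by rewrite w'E -scalemxAr mxE wi mulr0.
Qed.

(* The functional [(1, M, M^2, ...)] for [M] outside the finitely many roots of
   the polynomials with coefficients [w i]. *)
Lemma nonvanishing_functional (I : finType) (n : nat) (w : I -> 'cV[int]_n) :
  (forall i, w i != 0) ->
  exists xi : 'rV[int]_n, forall i, (xi *m w i) 0 0 != 0.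
Proof.
move=> w0; pose p i : {poly rat} :=
  \poly_(j < n) (if insub j is Some k then (w i k 0)%:~R else 0).
have pE i (k : 'I_n) : (p i)`_k = (w i k 0)%:~R.
  by rewrite coef_poly ltn_ord valK.
have p0 i : p i != 0.
  have /matrix0Pn[k [j]] := w0 i; rewrite ord1; apply: contraNneq => pi0.
  by rewrite -(intr_eq0 rat) -pE pi0 coef0.
have [M PM] : exists M : int, (\prod_i p i).[M%:~R] != 0.
  apply: contrapT => nM; have /eqP/prodf_eq0[i _] : \prod_i p i = 0.
    apply: (@poly_eq0_large _ _ 0) => M _; apply/eqP;
      apply: contrapT => /negP PM.
    by apply: nM; exists M.
  by rewrite (negbTE (p0 i)).
exists (\row_j M ^+ j) => i; rewrite -(intr_eq0 rat).
have : (p i).[M%:~R] != 0.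
  by move: PM; rewrite horner_prod => /prodf_neq0; apply.
rewrite horner_poly mxE rmorph_sum /=; congr (_ != _).
apply: eq_bigr => j _; rewrite valK mxE rmorphM rmorphXn /=; ring.
Qed.

(** One kernel vector is fixed for each of the finitely many [K]. A functional that vanishes on none
    of them becomes positive on all after sign changes of the vectors. *)
Lemma generic_functional (m n : nat) (A : 'M[int]_(m, n)) :
  exists xi : 'rV[int]_n, forall K : {set 'I_m}, (#|K| < n)%N ->
    exists2 w : 'cV[int]_n, (forall i, i \in K -> (A *m w) i 0 = 0)
      & 0 < (xi *m w) 0 0.
Proof.
pose T := {K : {set 'I_m} | (#|K| < n)%N}.
have wE (K : T) : exists w : 'cV[int]_n, w != 0 /\ forall i, i \in val K ->
  (A *m w) i 0 = 0.
  by have [w] := integral_kernel_vector A (valP K); exists w.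
have [w {}wE] := choice wE.
have [xi xiE] := nonvanishing_functional (fun K : T => (wE K).1).
exists xi => K ltK; pose K' : T := exist _ K ltK.
have [_ wK] := wE K'; have := xiE K'; rewrite neq_lt => /orP[xiw|xiw].
  exists (- w K') => [i iK|]; rewrite mulmxN mxE; first by rewrite wK ?oppr0.
  by rewrite oppr_gt0.
by exists (w K').
Qed.

(** * Decomposition into half-open simplicial cones *)

Section half_open_lines.
Context {R : realFieldType} {m : nat}.
Implicit Types (f d s : 'I_m -> R) (o : 'I_m -> bool) (i k : 'I_m).

(* Of two constraints on the same side of a line, both tight at the same point,
   the strict one is the more restrictive, then the one of smaller index:
   [tie_strict o k i] states that [i] is more restrictive than [k]. *)
Definition tie_strict o k i :=
  if o k then o i && (i < k)%N else o i || (i < k)%N.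

(** The choice is lexicographic: largest [v], then strict constraints before weak ones, then
    smallest index. *)
Lemma most_restrictive (S : pred 'I_m) (v : 'I_m -> R) o : (exists i, S i) ->
  exists2 k, S k & forall i, S i ->
    (v i < v k ?<= if (i == k) || ~~ tie_strict o k i).
Proof.
move=> [i0 Si0].
have [k1 Sk1 k1max] : exists2 k1, S k1 & forall i, S i -> v i <= v k1.
  by case: (@arg_maxP _ _ _ i0 S v Si0) => k Sk kmax; exists k.
pose S1 := [pred i | S i && (v i == v k1)].
have S1k1 : S1 k1 by rewrite /= Sk1 eqxx.
have vE i : S1 i -> v i = v k1 by move=> /andP[_ /eqP].
have tieE k : S1 k -> (forall i, S1 i -> (i == k) || ~~ tie_strict o k i) ->
    forall i, S i -> (v i < v k ?<= if (i == k) || ~~ tie_strict o k i).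
  move=> S1k kE i Si; have [ik|nik] := eqVneq (v i) (v k).
    have S1i : S1 i by rewrite /= Si ik (vE k)/=.
    by rewrite (kE i S1i) /= ik lexx.
  by rewrite lteifS// lt_neqAle nik (vE k)// k1max.
have [/existsP[k2 /andP[S1k2 ok2]]|/existsPn no] :=
  boolP [exists i, S1 i && o i].
  have [k /andP[S1k ok] kmin] :=
    @arg_minnP _ k2 [pred i | S1 i && o i] val (introT andP (conj S1k2 ok2)).
  exists k; first by case/andP: S1k.
  apply: tieE => // i S1i; rewrite /tie_strict ok negb_and -leqNgt.
  by case: (boolP (o i)) => oi; rewrite ?orbT//= kmin ?orbT//= oi andbT.
have [k S1k kmin] := @arg_minnP _ k1 S1 val S1k1.
exists k; first by case/andP: S1k.
have noS i : S1 i -> o i = false by move=> S1i; have := no i;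
  rewrite S1i => /negbTE.
by apply: tieE => // i S1i; rewrite /tie_strict !noS// -leqNgt kmin// orbT.
Qed.

Lemma most_restrictive_uniq (v : 'I_m -> R) o k k' :
  (v k' < v k ?<= if (k' == k) || ~~ tie_strict o k k') ->
  (v k < v k' ?<= if (k == k') || ~~ tie_strict o k' k) -> k = k'.
Proof.
rewrite eq_sym; have [//|nkk'] := eqVneq k k'; rewrite /tie_strict /= => vk vk'.
have [E|] := eqVneq (v k) (v k'); last first.
  rewrite neq_lt => /orP[] lt.
    by move/lteifW: vk; rewrite leNgt lt.
  by move/lteifW: vk'; rewrite leNgt lt.
move: vk vk'; rewrite E !lteifxx => vk vk'; exfalso.
move: nkk'; rewrite -val_eqE neq_ltn.
by move: vk vk'; case: (o k); case: (o k') => //= /negbTE -> /negbTE ->.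
Qed.

Lemma lteif_nmulr_gt0 (x y : R) b : y < 0 ->
  (0 < x * y ?<= if b) = (x < 0 ?<= if b).
Proof. by move=> y0; case: b; rewrite /= ?nmulr_lgt0 ?nmulr_lge0. Qed.

Lemma lteif_pmulr_gt0 (x y : R) b : 0 < y ->
  (0 < x * y ?<= if b) = (0 < x ?<= if b).
Proof. by move=> y0; case: b; rewrite /= ?pmulr_lgt0 ?pmulr_lge0. Qed.

Lemma lteif_subr_lt0 (x y : R) b : (x - y < 0 ?<= if b) = (x < y ?<= if b).
Proof. by case: b; rewrite /= ?subr_lt0 ?subr_le0. Qed.

Lemma lteif_subr_gt0 (x y : R) b : (0 < x - y ?<= if b) = (y < x ?<= if b).
Proof. by case: b; rewrite /= ?subr_gt0 ?subr_ge0. Qed.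

Lemma lteif_oppr_gt0 (x : R) b : (0 < - x ?<= if b) = (x < 0 ?<= if b).
Proof. by case: b; rewrite /= ?oppr_gt0 ?oppr_ge0. Qed.

Lemma lteif_trans_up (x y z : R) (ox oy oz t : bool) :
  (x < y ?<= if ~~ (ox || oy)) -> (y < z ?<= if t) -> (t -> oz -> oy) ->
  (x < z ?<= if ~~ (oz || ox)).
Proof.
case: ox; case: oy; case: oz; case: t => //= xy yz;
  try (by move=> /(_ isT isT)).
all: by move=> _; lra.
Qed.

Lemma lteif_trans_down (x y z : R) (ox oy oz t : bool) :
  (x < y ?<= if ~~ (ox || oy)) -> (z < x ?<= if t) -> (t -> oz -> ox) ->
  (z < y ?<= if ~~ (oz || oy)).
Proof.
case: ox; case: oy; case: oz; case: t => //= xy yz;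
  try (by move=> /(_ isT isT)).
all: by move=> _; lra.
Qed.

(* Strictness of the constraint [i] on the facet [k]. *)
Definition facet_strict d o k i :=
  if d i == 0 then o i
  else if (0 < d i) (+) (0 < d k) then o i || o k else tie_strict o k i.

(* [f i] and [d i] are the slack of the constraint [i] at the origin of a line
   and its rate of decrease.  The line meets the polyhedron in an interval,
   which contains the origin iff its lower end is nonpositive and its upper end
   is not negative; each end lies on exactly one facet [k], by
   [most_restrictive]. *)
Lemma line_indicator (K : pred 'I_m) f d o :
  (forall i, K i -> d i = 0) -> (exists i, 0 < d i) -> (exists i, d i < 0) ->
  [forall i, ~~ K i ==> (0 < f i ?<= if ~~ o i)]%:R =
  \sum_(k | d k != 0) - Num.sg (d k)
    * (0 < - (f k / d k) ?<= if ~~ (o k (+) (0 < d k)))%:R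
    * [forall i, ~~ (K i || (i == k)) ==>
         (0 < f i - f k / d k * d i ?<= if ~~ facet_strict d o k i)]%:R :> R.
Proof.
move=> dK dpos dneg.
pose s i := f i / d i.
have fE i : d i != 0 -> f i = s i * d i by move=> di; rewrite /s divfK.
(* The line enters the polyhedron at parameter [s k1] and leaves it at [s k2]. *)
have [k1 k1L k1E] := most_restrictive s o dneg.
have [k2 k2U k2E] := most_restrictive (fun i => - s i) o dpos.
have d1 : d k1 != 0 by rewrite lt_eqF.
have d2 : d k2 != 0 by rewrite gt_eqF.
have n2d1 : (0 < d k1) = false by rewrite ltNge (ltW k1L).
(* [Z] is the condition from the constraints parallel to the line; [compat] says that the interval
   between the two ends is nonempty, strictness included. *)
pose Z := [forall i, (~~ K i && (d i == 0)) ==> (0 < f i ?<= if ~~ o i)].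
pose compat := s k1 < s k2 ?<= if ~~ (o k1 || o k2).
pose ok k := [forall i, ~~ (K i || (i == k)) ==>
         (0 < f i - f k / d k * d i ?<= if ~~ facet_strict d o k i)].
have okE k i : d i != 0 -> f i - f k / d k * d i = (s i - s k) * d i.
  by move=> di; rewrite {1}fE// mulrBl.
have nK i : d i != 0 -> ~~ K i by move=> di; apply: contra_neqN di => /dK.
have k12 : k1 != k2 by apply: contraTneq k1L => ->; rewrite ltNge (ltW k2U).
have tieP k i : (i == k) || ~~ tie_strict o k i -> o i -> o k.
  move=> /predU1P[->//|]; rewrite /tie_strict; case: (o k) => //.
  by rewrite negb_or => /andP[/negbTE ->].
have k2E' i : 0 < d i -> s k2 < s i ?<= if (i == k2) || ~~ tie_strict o k2 i.
  by move=> di; have := k2E i di; rewrite lteifN2.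
have facet0 k i : d i == 0 ->
    (0 < f i - f k / d k * d i ?<= if ~~ facet_strict d o k i) =
      (0 < f i ?<= if ~~ o i).
  by move=> di; rewrite /facet_strict di (eqP di) mulr0 subr0.
have facetN k i : d i < 0 ->
    (0 < f i - f k / d k * d i ?<= if ~~ facet_strict d o k i) =
    (s i < s k ?<= if ~~ (if 0 < d k then o i || o k else tie_strict o k i)).
  move=> di; rewrite okE ?lt_eqF// lteif_nmulr_gt0// lteif_subr_lt0.
  by rewrite /facet_strict lt_eqF// [0 < d i]ltNge (ltW di).
have facetP k i : 0 < d i ->
    (0 < f i - f k / d k * d i ?<= if ~~ facet_strict d o k i) =
    (s k < s i ?<= if ~~ (if 0 < d k then tie_strict o k i else o i || o k)).
  move=> di; rewrite okE ?gt_eqF// lteif_pmulr_gt0// lteif_subr_gt0.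
  by rewrite /facet_strict gt_eqF// di /=; case: (0 < d k).
have okZ k : d k != 0 -> ok k -> Z.
  move=> dk /forallP kE; apply/forallP => i; apply/implyP => /andP[nKi di].
  have := kE i; rewrite facet0// negb_or nKi /=; case: eqVneq => [ik|_ //].
  by rewrite ik (negbTE dk) in di.
have ok1 : ok k1 = Z && compat.
  apply/idP/idP => [ok1|/andP[/forallP ZE compatE]].
    rewrite (okZ k1)//=; have /forallP/(_ k2) := ok1.
    by rewrite negb_or nK// eq_sym k12 facetP// n2d1 orbC.
  apply/forallP => i; apply/implyP; rewrite negb_or => /andP[nKi ik].
  have [di|di|di] := ltrgt0P (d i).
  - by rewrite facetP// n2d1; apply: lteif_trans_up compatE (k2E' i di) (tieP _
      _).
  - by rewrite facetN// n2d1; have := k1E i di; rewrite (negbTE ik).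
  - have di0 : d i == 0 by apply/eqP.
    by rewrite facet0//; have := ZE i; rewrite nKi di0.
have ok2 : ok k2 = Z && compat.
  apply/idP/idP => [ok2|/andP[/forallP ZE compatE]].
    rewrite (okZ k2)//=; have /forallP/(_ k1) := ok2.
    by rewrite negb_or nK// k12 facetN// k2U.
  apply/forallP => i; apply/implyP; rewrite negb_or => /andP[nKi ik].
  have [di|di|di] := ltrgt0P (d i).
  - by rewrite facetP// k2U; have := k2E' i di; rewrite (negbTE ik).
  - by rewrite facetN// k2U; apply: lteif_trans_down compatE (k1E i di) (tieP _
      _).
  - have di0 : d i == 0 by apply/eqP.
    by rewrite facet0//; have := ZE i; rewrite nKi di0.
have okL k : d k < 0 -> k != k1 -> ok k = false.
  move=> dk kk1; apply: contraNF kk1 => /forallP/(_ k1).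
  rewrite negb_or nK//= facetN// [0 < d k]ltNge (ltW dk) /= => kE.
  apply/eqP; apply: (@most_restrictive_uniq s o); last exact: k1E.
  by case: eqVneq kE => [-> _|_ //]; rewrite /= lexx.
have okU k : 0 < d k -> k != k2 -> ok k = false.
  move=> dk kk2; apply: contraNF kk2 => /forallP/(_ k2).
  rewrite negb_or nK//= facetP// dk /= => kE.
  apply/eqP; apply: (@most_restrictive_uniq (fun i => - s i) o);
    last exact: k2E.
  by rewrite lteifN2; case: eqVneq kE => [-> _|_ //]; rewrite /= lexx.
have -> : [forall i, ~~ K i ==> (0 < f i ?<= if ~~ o i)] =
    [&& Z, (s k1 < 0 ?<= if ~~ o k1) & (0 < s k2 ?<= if ~~ o k2)].
  apply/forallP/and3P => [fP|[/forallP ZE s1 s2] i].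
    split.
    - by apply/forallP => i; apply/implyP => /andP[nKi _]; have := fP i;
        rewrite nKi.
    - by have := fP k1; rewrite nK//= fE// lteif_nmulr_gt0.
    - by have := fP k2; rewrite nK//= fE// lteif_pmulr_gt0.
  apply/implyP => nKi; have [di|di|di] := ltrgt0P (d i).
  - rewrite fE ?gt_eqF// lteif_pmulr_gt0//.
    by have := @lteif_trans_up 0 _ _ false _ _ _ s2 (k2E' i di) (tieP _ _);
      rewrite orbF.
  - rewrite fE ?lt_eqF// lteif_nmulr_gt0//; rewrite -(orbF (o k1)) in s1.
    by have := @lteif_trans_down _ 0 _ _ false _ _ s1 (k1E i di) (tieP _ _);
      rewrite orbF.
  - have di0 : d i == 0 by apply/eqP.
    by have := ZE i; rewrite nKi di0.
rewrite (bigD1 k1)//= (bigD1 k2) /=; last by rewrite d2 eq_sym.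
rewrite big1 ?addr0 => [|k /andP[/andP[dk kk1] kk2]]; last first.
  rewrite -/(ok k) (_ : ok k = false) ?mulr0//.
  by move: dk; rewrite neq_lt => /orP[/okL->|/okU->].
rewrite -/(ok k1) -/(ok k2) ok1 ok2 ltr0_sg// gtr0_sg// n2d1 k2U -/(s k1) -/(s
  k2) addbF addbT negbK.
rewrite !lteif_oppr_gt0 opprK mul1r.
have -> : (s k2 < 0 ?<= if o k2) = ~~ (0 < s k2 ?<= if ~~ o k2).
  by rewrite -lteifNE negbK.
(* Let [a] and [b] say that the origin is on the right side of the lower and upper end. The two
   surviving terms add up to [a + b - 1] if [Z] and [compat] hold. This equals the indicator of
   both, since the origin cannot violate both ends of a nonempty interval. *)
have H1 : (s k1 < 0 ?<= if ~~ o k1) -> (0 < s k2 ?<= if ~~ o k2) -> compat.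
  by rewrite /compat; case: (o k1); case: (o k2) => /=; lra.
have H2 : compat -> (s k1 < 0 ?<= if ~~ o k1) || (0 < s k2 ?<= if ~~ o k2).
  rewrite /compat; case: (o k1); case: (o k2) => /=;
  by case: (ltrgtP (s k1) 0) => //; case: (ltrgtP (s k2) 0) => //=; lra.
move: H1 H2.
move: (Z) (compat) (s k1 < 0 ?<= if ~~ o k1) (0 < s k2 ?<= if ~~ o k2).
by move=> [] [] [] [] /= H1 H2;
  first [by have := H2 isT|by have := H1 isT isT|ring].
Qed.

End half_open_lines.

Section cones.
Context {R : realType} {n : nat}.

(* A generator [ray_dir] of a simplicial cone with its coordinate functional
   [ray_form]; the coordinate ranges over [0, +oo[, or ]0, +oo[ if [ray_open],
   and over [0, 1[, or ]0, 1] if [ray_open], if [ray_box]. *)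
Definition ray : choiceType := ('rV[R]_n * 'cV[R]_n * bool * bool)%type.
Definition ray_form (r : ray) : 'rV[R]_n := r.1.1.1.
Definition ray_dir (r : ray) : 'cV[R]_n := r.1.1.2.
Definition ray_open (r : ray) : bool := r.1.2.
Definition ray_box (r : ray) : bool := r.2.

Definition ray_range (r : ray) (t : R) : bool :=
  (0 < t ?<= if ~~ ray_open r) && (ray_box r ==> (t < 1 ?<= if ray_open r)).

Fixpoint cone (l : seq ray) (u : 'cV[R]_n) : bool :=
  if l is r :: l' then
    let t := (ray_form r *m u) 0 0 in ray_range r t && cone l' (u - t *:
      ray_dir r)
  else u == 0.

(** The duality is triangular: a form vanishes on the later directions only, which suffices because
    [cone] peels off the coordinates in turn. *)
Fixpoint dual_rays (xi : 'rV[R]_n) (l : seq ray) : Prop :=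
  if l is r :: l' then
    [/\ Zvec (ray_dir r), 0 < (xi *m ray_dir r) 0 0,
        (ray_form r *m ray_dir r) 0 0 = 1,
        (forall r', r' \in l' -> (ray_form r *m ray_dir r') 0 0 = 0)
      & dual_rays xi l']
  else True.

End cones.
Arguments ray R n : clear implicits.

(** * Recursive decomposition of a polyhedron *)

Section cone_decomposition.
Context {R : realType} {m n : nat}.
Variables (A : 'M[R]_(m, n)) (xi : 'rV[R]_n) (Y : set 'cV[R]_m).
Implicit Types (K : {set 'I_m}) (o : 'I_m -> bool).

(** A signed sum of cones with apexes given by bases: the apexes move with [beta], while
    coefficients and rays stay fixed. *)
Record signed_cones := SignedCones {
  sc_index : finType;
  sc_coef : sc_index -> R;
  sc_base : sc_index -> base A;
  sc_rays : sc_index -> seq (ray R n) }.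

Definition half_open K o (beta : 'cV[R]_m) (x : 'cV[R]_n) : bool :=
  [forall i, (i \notin K) ==> (0 < slack A beta x i ?<= if ~~ o i)].

Definition good_cone K d (D : signed_cones) (j : sc_index D) : Prop :=
  [/\ {subset K <= base_set (sc_base j)},
      forall beta, Y beta -> polyhedron A beta (base_point (sc_base j) beta),
      dual_rays xi (sc_rays j), size (sc_rays j) = d
    & forall r, r \in sc_rays j ->
        ray_box r = false /\ forall i, i \in K -> (A *m ray_dir r) i 0 = 0].

Definition decomposes K o (D : signed_cones) : Prop :=
  forall beta x, Y beta -> (forall i, i \in K -> slack A beta x i = 0) ->
    (half_open K o beta x)%:R =
    \sum_j sc_coef j * (cone (sc_rays j) (x - base_point (@sc_base D j)
      beta))%:R.

Hypothesis generic_xi : forall K, (#|K| < n)%N -> exists2 w : 'cV[R]_n, Zvec w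
  & (forall i, i \in K -> (A *m w) i 0 = 0) /\ 0 < (xi *m w) 0 0.
Hypothesis recession0 : forall w : 'cV[R]_n, (forall i, (A *m w) i 0 <= 0) ->
  w = 0.
Hypothesis sgY : forall (I : base A) i beta beta', Y beta -> Y beta' ->
  Num.sg (slack A beta (base_point I beta) i) =
  Num.sg (slack A beta' (base_point I beta') i).

(** The face is a single point. By [sgY], whether it satisfies the remaining constraints is the same
    for all [beta] in [Y], so one apex without rays or the empty sum serves them all. *)
Lemma base_decomposition K o : indep_rows A K -> #|K| = n ->
  exists D, (forall j, @good_cone K 0 D j) /\ decomposes K o D.
Proof.
move=> indK cK; have [I IK] := indep_rows_base indK cK.
have VE beta x : (forall i, i \in K -> slack A beta x i = 0) ->
  x = base_point I beta.
  by rewrite -IK => /base_pointP.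
have [[beta0 Y0 h0]|nh] := pselect (exists2 beta,
  Y beta & half_open K o beta (base_point I beta)).
  have hE beta : Y beta -> half_open K o beta (base_point I beta).
    move=> Yb; apply/forallP => i; apply/implyP => niK.
    have /forallP/(_ i)/implyP/(_ niK) := h0.
    by case: (o i) => /=; rewrite ?(eq_sgr_gt0 (sgY I i Yb Y0)) ?(eq_sgr_ge0
      (sgY I i Yb Y0)).
  exists (@SignedCones unit (fun=> 1) (fun=> I) (fun=> [::]));
    split=> [[]|beta x Yb /VE ->].
    split=> //=; first by rewrite IK.
    move=> beta /hE/forallP hb i; have [iK|niK] := boolP (i \in K).
      by rewrite slack_base_point ?IK.
    by have /implyP/(_ niK)/lteifW := hb i.
  by rewrite hE//= (big_pred1 tt) => [|[]]//; rewrite subrr eqxx mulr1.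
exists (@SignedCones void (fun=> 1) (fun=> I) (fun=> [::]));
  split=> [[]|beta x Yb /VE ->].
rewrite big1 => [|[]//]; case: (boolP (half_open _ _ _ _)) => // hb.
by case: nh; exists beta.
Qed.

(** Induction on the dimension [d] of the face. [line_indicator] along [w] reduces it to the facets
    [k |: K], and each cone of a facet acquires the ray [w]. *)
Lemma polyhedron_decomposition d K o : (d + #|K|)%N = n -> indep_rows A K ->
  exists D, (forall j, @good_cone K d D j) /\ decomposes K o D.
Proof.
elim: d K o => [|d IHd] K o dK indK; first exact: base_decomposition.
have [|w wZ [wK xiw]] := generic_xi (K := K);
  first by rewrite -dK addSn ltnS leq_addl.
pose a i := (A *m w) i 0.
have w0 : w != 0 by apply: contraTneq xiw => ->; rewrite mulmx0 mxE ltxx.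
(* Neither [w] nor [- w] is a recession direction, so the line is bounded on both sides. *)
have apos : exists i, 0 < a i.
  apply: contrapT => na; case/eqP: w0; apply: recession0 => i.
  by rewrite leNgt; apply/negP => ai; apply: na; exists i.
have aneg : exists i, a i < 0.
  apply: contrapT => na; case/eqP: w0; apply/eqP; rewrite -oppr_eq0; apply/eqP.
  apply: recession0 => i; rewrite mulmxN mxE oppr_le0 leNgt.
  by apply/negP => ai; apply: na; exists i.
have aK i : i \in K -> a i = 0 by exact: wK.
have /choice[D DE] (k : 'I_m) : exists D : signed_cones,
    (forall j, a k != 0 /\ @good_cone (k |: K)%SET d D j) /\
    (a k != 0 -> decomposes (k |: K)%SET (facet_strict a o k) D).
  have [ak|ak] := eqVneq (a k) 0.
    (* A constraint parallel to [w] gets the empty sum. *)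
    by exists (@SignedCones void (fun=> 1) (of_void _) (of_void _));
      split=> [[]|].
  have nkK : k \notin K by apply: contra_neqN ak => /aK.
  have [||D [D1 D2]] := IHd (k |: K)%SET (facet_strict a o k).
  - by rewrite cardsU1 nkK add1n addnS -addSn.
  - exact: indep_rowsU1 wK ak.
  by exists D; split.
(* The line through [x] meets hyperplane [k] at [x + (slack / a k) *: w]. Relative to an apex tight
   on [k], the new form takes the value [- slack / a k] at [x], the coordinate along [w] from that
   point. *)
pose newray k : ray R n := ((a k)^-1 *: row k A, w, o k (+) (0 < a k), false).
have newformE k u : (ray_form (newray k) *m u) 0 0 = (A *m u) k 0 / a k.
  by rewrite /ray_form /= -scalemxAl mxE -row_mul mxE mulrC.
exists (@SignedCones {k : 'I_m & sc_index (D k)}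
  (fun p => - Num.sg (a (tag p)) * sc_coef (tagged p))
  (fun p => sc_base (tagged p)) (fun p =>
    newray (tag p) :: sc_rays (tagged p))).
split=> [[k j]|beta x Yb xK].
  have [/(_ j)[ak [jK jP jr js jrK]] _] := DE k; split=> //=.
  - by move=> i iK; apply: jK; rewrite finset.inE iK orbT.
  - split=> //; first by rewrite newformE divff.
    move=> r rj; rewrite newformE (jrK r rj).2 ?mul0r//.
    by rewrite finset.inE set11.
  - by rewrite js.
  - move=> r /predU1P[->//|/jrK[rb rK]]; split=> // i iK.
    by apply: rK; rewrite finset.inE iK orbT.
rewrite /half_open.
have := line_indicator (slack A beta x) o aK apos aneg.
move=> ->.
rewrite -(@sig_big_dep _ _ _ _ _ xpredT (fun _ => xpredT) (fun k j =>
  - Num.sg (a k) * sc_coef j *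
   (cone (newray k :: sc_rays j) (x - base_point (sc_base j) beta))%:R)) /=.
rewrite big_mkcond; apply: eq_bigr => k _; case: ifP => [ak|/negbFE ak];
  last first.
  by apply/esym/big1 => j _; have [/(_ j)[]] := DE k; rewrite ak.
have [Dj /(_ ak) DkE] := DE k.
have {}DkE := DkE beta (x + (slack A beta x k / a k) *: w) Yb.
rewrite (_ : [forall i, _] = half_open (k |: K)%SET (facet_strict a o k) beta
     (x + (slack A beta x k / a k) *: w)); last first.
  by apply: eq_forallb => i; rewrite !finset.inE orbC slackD.
rewrite DkE => [|i]; last first.
  rewrite !finset.inE slackD => /predU1P[->|iK]; first by rewrite divfK// subrr.
  by rewrite xK// wK// mulr0 subrr.
rewrite mulr_sumr; apply: eq_bigr => j _.
have [_ [jK _ _ _ _]] := Dj j.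
have kj : k \in base_set (sc_base j) by apply: jK; rewrite finset.inE set11.
rewrite newformE (slack_diff A beta) (slack_base_point _ kj) sub0r.
rewrite [- slack A beta x k / a k]mulNr scaleNr opprK [x + _ - _]addrAC.
by rewrite /ray_range /= andbT -[in RHS]mulnb natrM; ring.
Qed.

End cone_decomposition.

(** * Lattice points of cones *)

Section lattice_points.
Context {R : realType} {n : nat}.
Implicit Types (S : set 'cV[R]_n).

Lemma ZvecP (x : 'cV[R]_n) : Zvec x <-> exists z : 'cV[int]_n, x =
  map_mx intr z.
Proof.
split=> [/mxOverP xZ|[z ->]]; last by apply/mxOverP => i j;
  rewrite mxE intr_int.
have /choice[z zE] i : exists z : int, x i 0 = z%:~R.
  by have /intrP[z] := xZ i 0; exists z.
by exists (\col_i z i); apply/matrixP => i j; rewrite ord1 !mxE zE.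
Qed.

Lemma ZvecD (x y : 'cV[R]_n) : Zvec x -> Zvec y -> Zvec (x + y).
Proof. by move=> /mxOverP xZ /mxOverP yZ; apply/mxOverP => i j;
  rewrite mxE rpredD. Qed.

Lemma ZvecN (x : 'cV[R]_n) : Zvec x -> Zvec (- x).
Proof. by move=> /mxOverP xZ; apply/mxOverP => i j; rewrite mxE rpredN. Qed.

Lemma ZvecB (x y : 'cV[R]_n) : Zvec x -> Zvec y -> Zvec (x - y).
Proof. by move=> xZ yZ; apply: ZvecD => //; exact: ZvecN. Qed.

Lemma finite_lattice_points S (c : R) :
  (forall x, S x -> Zvec x /\ forall i, `|x i 0| <= c) -> finite_set S.
Proof.
move=> SE; pose N := Num.bound `|c|.
pose pt (f : {ffun 'I_n -> 'I_(N + N).+1}) : 'cV[R]_n :=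
  \col_i ((f i)%:R - N%:R).
apply: (@sub_finite_set _ _ (pt @` setT));
  last exact/finite_image/finite_finset.
move=> x /SE[/ZvecP[z ->] zc].
exists [ffun i => inord (absz (z i 0 + N%:Z))] => //.
apply/matrixP => i j; rewrite ord1 !mxE ffunE.
have : (`|z i 0| <= N%:Z)%R.
  rewrite -(ler_int R) intr_norm; have := zc i; rewrite mxE => /le_trans; apply.
  apply: (le_trans (ler_norm c)); by apply: ltW; exact/archi_boundP/normr_ge0.
move=> zN; rewrite inordK; last by lia.
have -> : (absz (z i 0 + N%:Z))%:R = (z i 0 + N%:Z)%:~R :> R.
  by rewrite -[LHS]/((Posz _)%:~R); congr (_%:~R); lia.
by rewrite rmorphD /= addrK.
Qed.

Definition npts S : nat := #|` fset_set S|%fset.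

(** Counts over a common finite window [W] turn pointwise identities of indicators into identities
    of counts. *)
Lemma npts_sum S (W : {fset 'cV[R]_n}) : (forall x, S x -> x \in W) ->
  (npts S)%:R = \sum_(x <- W) `[< S x >]%:R :> R.
Proof.
move=> SW; have finS : finite_set S.
  by apply: (@sub_finite_set _ _ [set` W]) => [x /SW//|]; exact: finite_fset.
rewrite -natr_sum /npts; congr _%:R.
rewrite (_ : \sum_(x <- W) `[< S x >] = count (fun x => `[< S x >]) W)%N;
  last first.
  by rewrite -sum1_count [RHS]big_mkcond.
rewrite -size_filter; apply: perm_size; apply: uniq_perm.
- exact: fset_uniq.
- by rewrite filter_uniq// fset_uniq.
move=> x; rewrite mem_filter in_fset_set//.
by apply/idP/andP => [/set_mem xS|[/asboolP xS _]]; [split;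
  [exact/asboolP|exact: SW]|exact: mem_set].
Qed.

Lemma npts_shift S g : finite_set S -> npts [set x | S (x - g)] = npts S.
Proof.
move=> finS; rewrite /npts.
have -> : [set x | S (x - g)] = (fun x => x + g) @` S.
  apply/seteqP; split=> [x xS|_ [x xS <-]]; last by rewrite /= addrK.
  by exists (x - g); rewrite ?subrK.
by rewrite fset_set_image// card_imfset//= => x y /addIr.
Qed.

End lattice_points.

(** * Counting lattice points of a cone below a given height *)

Section cone_counting.
Context {R : realType} {n : nat}.
Variable xi0 : 'rV[int]_n.
Local Notation xi := (map_mx intr xi0 : 'rV[R]_n).
Implicit Types (l : seq (ray R n)) (u v : 'cV[R]_n).

Lemma xi_int x : Zvec x -> exists z : int, (xi *m x) 0 0 = z%:~R.
Proof.
move=> /ZvecP[z ->]; exists ((xi0 *m z) 0 0).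
by rewrite -map_mxM [LHS]mxE.
Qed.

(** For an integral direction on which [xi] is positive, [Num.truncn] rounds nothing: the value is
    already a natural number. *)
Definition height (r : ray R n) : nat := Num.truncn ((xi *m ray_dir r) 0 0).

Lemma heightE r : Zvec (ray_dir r) -> 0 < (xi *m ray_dir r) 0 0 ->
  (0 < height r)%N /\ (xi *m ray_dir r) 0 0 = (height r)%:R.
Proof.
move=> /xi_int[z zE]; rewrite /height zE ltr0z => z0.
have -> : z%:~R = (absz z)%:R :> R by rewrite -[RHS]/((Posz _)%:~R) gtz0_abs.
by rewrite natrK absz_gt0 gt_eqF.
Qed.

Lemma form_sub (a : 'rV[R]_n) (x y : 'cV[R]_n) t :
  (a *m (x - t *: y)) 0 0 = (a *m x) 0 0 - t * (a *m y) 0 0.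
Proof. by rewrite mulmxBr -scalemxAr [LHS]mxE [X in _ + X]mxE [X in - X]mxE.
  Qed.

Lemma cone_xi_ge0 l u : dual_rays xi l -> cone l u -> 0 <= (xi *m u) 0 0.
Proof.
elim: l u => [|r l IH] u /=; first by move=> _ /eqP ->; rewrite mulmx0 mxE.
move=> [_ xir _ _ lE] /andP[/andP[/lteifW t0 _] /(IH _ lE)].
rewrite form_sub subr_ge0; apply: le_trans.
by rewrite mulr_ge0// ltW.
Qed.

(** [xi] is the sum of the coordinates weighted by the heights, which are at least 1; hence each
    coordinate is at most [c]. *)
Lemma cone_bounded l u c i : dual_rays xi l -> cone l u -> (xi *m u) 0 0 <= c ->
  `|u i 0| <= c * \sum_(r <- l) `|ray_dir r i 0|.
Proof.
elim: l u => [|r l IH] u /=.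
  by move=> _ /eqP -> _; rewrite big_nil mulr0 mxE normr0.
move=> [rZ xir _ _ lE] /andP[/andP[/lteifW + _]]; set t :=
  (_ *m u) 0 0 => t0 lu uc.
have [h0 hE] := heightE rZ xir.
have uE : (xi *m u) 0 0 = t * (height r)%:R + (xi *m (u - t *: ray_dir r)) 0 0.
  by rewrite form_sub hE addrC subrK.
have u'0 := cone_xi_ge0 lE lu.
have h1 : 1 <= (height r)%:R :> R by rewrite ler1n.
have tc : t <= c by nra.
have u'c : (xi *m (u - t *: ray_dir r)) 0 0 <= c by nra.
rewrite big_cons mulrDr -{1}[u](subrK (t *: ray_dir r)) mxE addrC.
apply: (le_trans (ler_normD _ _)); apply: lerD; last exact: IH.
by rewrite mxE normrM ger0_norm// ler_wpM2r.
Qed.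

Lemma cone_box_le l u : dual_rays xi l -> (forall r, r \in l -> ray_box r) ->
  cone l u -> (xi *m u) 0 0 <= \sum_(r <- l) (xi *m ray_dir r) 0 0.
Proof.
elim: l u => [|r l IH] u /=.
  by move=> _ _ /eqP ->; rewrite big_nil mulmx0 mxE.
move=> [rZ xir _ _ lE] lb /andP[/andP[_]]; rewrite lb ?mem_head//= =>
  /lteifW t1 lu.
have lb' r' : r' \in l -> ray_box r' by move=> r'l;
  rewrite lb// in_cons r'l orbT.
by have := IH _ lE lb' lu; rewrite form_sub big_cons; nra.
Qed.

Definition boxed (r : ray R n) : ray R n := (r.1, true).

Lemma dual_rays_boxed l1 r l2 :
  dual_rays xi (l1 ++ r :: l2) -> dual_rays xi (l1 ++ boxed r :: l2).
Proof.
elim: l1 => [|r1 l1 IH] //= [r1Z xir1 r11 r1E lE]; split=> //; last exact: IH.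
move=> r'; rewrite mem_cat in_cons => r'E.
have [->|nr'] := eqVneq r' (boxed r).
  by rewrite -[ray_dir _]/(ray_dir r) r1E// mem_cat mem_head orbT.
by rewrite r1E// mem_cat in_cons; move: r'E; rewrite (negbTE nr') /= =>
  /orP[]->; rewrite ?orbT.
Qed.

(** The coordinate along [r] either stays in range after subtracting 1 or lies in the box; the
    boundary value 1 goes to the box exactly when the ray is open. *)
Lemma cone_box_split l1 r l2 u : dual_rays xi (l1 ++ r :: l2) ->
  ray_box r = false ->
  (cone (l1 ++ r :: l2) u = cone (l1 ++ r :: l2) (u - ray_dir r)
     + cone (l1 ++ boxed r :: l2) u :> nat)%N.
Proof.
move=> + rb; elim: l1 u => [|r1 l1 IH] u /=.
  move=> [_ _ r1 _ _]; rewrite -[ray_form (boxed r)]/(ray_form r).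
  set t := (_ *m u) 0 0; have -> : (ray_form r *m (u - ray_dir r)) 0 0 = t - 1.
    by rewrite -[ray_dir r in LHS]scale1r form_sub r1 mul1r.
  have -> : u - ray_dir r - (t - 1) *: ray_dir r = u - t *: ray_dir r.
    by rewrite scalerBl scale1r opprB addrA subrK.
  rewrite -[ray_dir (boxed r)]/(ray_dir r); case: (cone l2 _);
    last by rewrite !andbF.
  rewrite !andbT /ray_range rb -[ray_box (boxed r)]/true -[ray_open (boxed
    r)]/(ray_open r) /=.
  case: (ray_open r) => /=; rewrite ?subr_gt0 ?subr_ge0 !andbT.
    by have [t1|_] := ltP 1 t; rewrite ?andbT// (lt_trans ltr01 t1).
  by have [t1|_] := leP 1 t; rewrite ?andbT// (le_trans ler01 t1).
move=> [_ _ _ r1E lE]; have -> : (ray_form r1 *m (u - ray_dir r)) 0 0 =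
  (ray_form r1 *m u) 0 0.
  by rewrite -[ray_dir r in LHS]scale1r form_sub r1E ?mulr0 ?subr0// mem_cat
    mem_head orbT.
by rewrite [u - _ - _]addrAC -!mulnb -mulnDr IH.
Qed.

Definition cone_points l v (M : int) : set 'cV[R]_n :=
  [set x | [/\ Zvec x, cone l (x - v) & (xi *m x) 0 0 <= M%:~R]].

Lemma finite_cone_points l v M : dual_rays xi l ->
  finite_set (cone_points l v M).
Proof.
move=> lE; pose c := M%:~R - (xi *m v) 0 0.
pose b := \sum_i (c * \sum_(r <- l) `|ray_dir r i 0| + `|v i 0|).
apply: (@finite_lattice_points _ _ _ b) => x [xZ xl xM]; split=> // i.
have xE : (xi *m (x - v)) 0 0 <= c.
  by rewrite -[v]scale1r form_sub mul1r /c lerB.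
have ub j : `|x j 0| <= c * \sum_(r <- l) `|ray_dir r j 0| + `|v j 0|.
  rewrite -{1}[x](subrK v) [X in `|X|]mxE (le_trans (ler_normD _ _))// lerD2r.
  exact: cone_bounded.
apply: (le_trans (ub i)); rewrite /b (bigD1 i)//= lerDl sumr_ge0// => j _.
exact: le_trans (ub j).
Qed.

Definition cone_count l v M : R := (npts (cone_points l v M))%:R.

(** Translation by the integral vector [ray_dir r] raises [xi] by [height r] and maps the points up
    to [M] onto those outside the box. *)
Lemma cone_count_split l1 r l2 v (M : int) :
  dual_rays xi (l1 ++ r :: l2) -> ray_box r = false ->
  Zvec (ray_dir r) -> 0 < (xi *m ray_dir r) 0 0 ->
  cone_count (l1 ++ r :: l2) v (M + (height r)%:Z) =
  cone_count (l1 ++ r :: l2) v M + cone_count (l1 ++ boxed r :: l2) v (M +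
    (height r)%:Z).
Proof.
move=> lE rb rZ xir; have [_ hE] := heightE rZ xir.
have fin M' := finite_cone_points v M' lE.
have finb M' := finite_cone_points v M' (dual_rays_boxed lE).
pose W := fset_set (cone_points (l1 ++ r :: l2) v (M + (height r)%:Z)).
have inW x : cone_points (l1 ++ r :: l2) v (M + (height r)%:Z) x -> x \in W.
  by move=> xP; rewrite in_fset_set ?mem_set.
have cE x : (cone (l1 ++ r :: l2) (x - v) =
  cone (l1 ++ r :: l2) (x - ray_dir r - v)
     + cone (l1 ++ boxed r :: l2) (x - v) :> nat)%N.
  by rewrite (cone_box_split _ lE rb) [x - _ - _]addrAC.
have xiE x : ((xi *m (x - ray_dir r)) 0 0 <= M%:~R) =
  ((xi *m x) 0 0 <= (M + (height r)%:Z)%:~R).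
  by rewrite -[ray_dir r]scale1r form_sub mul1r hE intrD lerBlDr.
have ZE x : Zvec (x - ray_dir r) <-> Zvec x.
  by split=> [/ZvecD/(_ rZ)|/ZvecB]; [rewrite subrK|apply].
rewrite /cone_count -(npts_shift (ray_dir r) (fin M)).
rewrite !(@npts_sum _ _ _ W) => [||x [/ZE xZ cx]|//].
- rewrite -big_split; apply: eq_bigr => x _ /=.
  rewrite -natrD; congr _%:R.
  have [xZ|nxZ] := pselect (Zvec x); last first.
    rewrite !asboolF => [//|[]//|[/ZE]//|[]//].
  have [xM|nxM] := boolP ((xi *m x) 0 0 <= (M + (height r)%:Z)%:~R); last first.
    rewrite !asboolF => [//|[_ _]|[_ _]|[_ _]]; rewrite ?xiE; exact/negP.
  have E l' u : `[< [/\ Zvec x,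
    cone l' u & (xi *m x) 0 0 <= (M + (height r)%:Z)%:~R] >] = cone l' u.
    by apply/asboolP/idP => [[]|].
  have E' : `[< cone_points (l1 ++ r :: l2) v M (x - ray_dir r) >] =
      cone (l1 ++ r :: l2) (x - ray_dir r - v).
    by apply/asboolP/idP => [[]//|cx]; split=> //; [exact/ZE|rewrite xiE].
  by rewrite !E E' cE.
- by move=> x [xZ cx xM]; apply: inW; split=> //; have := cE x;
    rewrite cx addn1; case: (cone _ (x - v)).
- by rewrite xiE => xM; apply: inW; split=> //; have := cE x; rewrite cx add1n;
    case: (cone _ (x - v)).
Qed.

Lemma shift_poly_shift (p : {poly R}) (f : int -> R) (h M : int) :
  shift_poly p (fun N => f (N + h)) M = shift_poly p f (M + h).
Proof. by apply: eq_bigr => i _; rewrite addrAC. Qed.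

(** By [cone_count_split], each factor ['X^(height r) - 1] replaces a ray by its box. *)
Lemma shift_poly_cone_count l1 l2 v (M : int) :
  dual_rays xi (l1 ++ l2) -> (forall r, r \in l2 -> ray_box r = false) ->
  shift_poly (\prod_(r <- l2) ('X^(height r) - 1)) (cone_count (l1 ++ l2) v) M =
  cone_count (l1 ++ map boxed l2) v (M + (\sum_(r <- l2) height r)%N%:Z).
Proof.
elim: l2 l1 M => [|r l2 IH] l1 M lE lb.
  by rewrite !big_nil shift_polyC mul1r addr0.
have rb : ray_box r = false by rewrite lb// mem_head.
have [rZ xir] : Zvec (ray_dir r) /\ 0 < (xi *m ray_dir r) 0 0.
  by elim: l1 lE {IH} => [[]//|r1 l1 IHl [_ _ _ _ /IHl]].
have lbE := dual_rays_boxed lE.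
rewrite !big_cons mulrC shift_polyM.
rewrite (_ : shift_poly ('X^(height r) - 1) _ =
    fun N => cone_count (l1 ++ boxed r :: l2) v (N + (height r)%:Z));
      last first.
  by apply/funext => N; rewrite shift_polyXnB1 cone_count_split// addrC addKr.
rewrite shift_poly_shift -cat_rcons IH ?cat_rcons//.
  by rewrite -addrA -PoszD.
by move=> r' r'l; rewrite lb// in_cons r'l orbT.
Qed.

Lemma dual_rays_map_boxed l : dual_rays xi l -> dual_rays xi (map boxed l).
Proof.
elim: l => //= r l IH [rZ xir r1 rE lE]; split=> //; last exact: IH.
by move=> _ /mapP[r' /rE r'E ->].
Qed.

(** Once all rays are boxed, [xi] is bounded on the cone, so the count is constant for large [M] and
    ['X - 1] kills it. *)
Lemma cone_count_killed l v : dual_rays xi l ->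
  (forall r, r \in l -> ray_box r = false) ->
  exists M0 : int, forall M, M0 <= M ->
    shift_poly (('X - 1) * \prod_(h <- map height l) ('X^h - 1)) (cone_count l
      v) M = 0.
Proof.
move=> lE lb; have lbE := dual_rays_map_boxed lE.
pose c := \sum_(r <- map boxed l) (xi *m ray_dir r) 0 0 + (xi *m v) 0 0.
exists (Num.ceil c) => M cM;
  rewrite shift_polyM -['X]expr1 shift_polyXnB1 !big_map.
rewrite !(@shift_poly_cone_count [::] l)//=; apply/eqP; rewrite subr_eq0;
  apply/eqP.
have ptsE M' : Num.ceil c <= M' -> cone_points (map boxed l) v M' =
    [set x | Zvec x /\ cone (map boxed l) (x - v)].
  move=> cM'; apply/seteqP; split=> x [] // xZ xl; split=> //.
  apply: (@le_trans _ _ c); last by apply: (le_trans (ceil_ge c));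
    rewrite ler_int.
  have := @cone_box_le _ _ lbE _ xl;
    rewrite -[v in x - v]scale1r form_sub mul1r lerBlDr.
  by apply=> r /mapP[r' _ ->].
by rewrite /cone_count !ptsE// (le_trans cM)// -?addrA lerDl.
Qed.

End cone_counting.

(** * Polynomial functions *)

Section polynomial_functions.
Context {R : realType} {n : nat}.
Implicit Types (F G : 'cV[R]_n -> R).

Definition polynomial_function d F : Prop :=
  exists c : multi_index n d -> R, forall y, F y = \sum_j c j * monomial j y.

(** A list with possible repetitions and unbounded exponent type makes closure under sums and under
    multiplication by a coordinate immediate. *)
Definition monomial_span d F : Prop :=
  exists s : seq (R * {ffun 'I_n -> nat}),
    (forall t, t \in s -> (\sum_i t.2 i <= d)%N) /\
    forall y, F y = \sum_(t <- s) t.1 * \prod_i y i 0 ^+ t.2 i.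

Lemma monomial_spanW d d' F : (d <= d')%N -> monomial_span d F ->
  monomial_span d' F.
Proof. by move=> dd' [s [sd sE]]; exists s; split=> // t /sd /leq_trans;
  apply. Qed.

Lemma monomial_span0 d : monomial_span d (fun=> 0).
Proof. by exists [::]; split=> // y; rewrite big_nil. Qed.

Lemma monomial_spanD d F G : monomial_span d F -> monomial_span d G ->
  monomial_span d (fun y => F y + G y).
Proof.
move=> [s [sd sE]] [t [td tE]]; exists (s ++ t); split=> [r|y].
  by rewrite mem_cat => /orP[/sd|/td].
by rewrite big_cat sE tE.
Qed.

Lemma monomial_span_sum (T : Type) (r : seq T) d (F : T -> 'cV[R]_n -> R) :
  (forall t, monomial_span d (F t)) -> monomial_span d (fun y =>
    \sum_(t <- r) F t y).
Proof.
move=> FE; elim: r => [|t r IH].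
  have [s [sd sE]] := monomial_span0 d; exists s; split=> // y.
  by rewrite big_nil; exact: sE.
have [s [sd sE]] := monomial_spanD (FE t) IH; exists s; split=> // y.
by rewrite big_cons; exact: sE.
Qed.

Lemma monomial_spanZ d c F : monomial_span d F -> monomial_span d (fun y =>
  c * F y).
Proof.
move=> [s [sd sE]]; exists [seq (c * t.1, t.2) | t <- s];
  split=> [_ /mapP[t /sd ? ->]//|y].
by rewrite big_map sE mulr_sumr; apply: eq_bigr => t _; rewrite mulrA.
Qed.

Lemma monomial_span_coord d F i : monomial_span d F ->
  monomial_span d.+1 (fun y => y i 0 * F y).
Proof.
move=> [s [sd sE]].
exists [seq (t.1, [ffun k => (t.2 k + (k == i))%N])
  | t : R * {ffun 'I_n -> nat} <- s]; split=> [_ /mapP[t /sd td ->]|y].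
  rewrite /= (eq_bigr (fun k => t.2 k + (k == i))%N) => [|k _];
    last by rewrite ffunE.
  by rewrite big_split /= -[X in (_ + X)%N]big_mkcond /= big_pred1_eq addn1.
rewrite big_map sE mulr_sumr; apply: eq_bigr => t _ /=; rewrite mulrCA;
  congr (_ * _).
rewrite [RHS](eq_bigr (fun k =>
  y k 0 ^+ t.2 k * (if k == i then y k 0 else 1))).
  by rewrite big_split /= -big_mkcond /= big_pred1_eq mulrC.
by move=> k _; rewrite ffunE exprD; case: eqP => _; rewrite ?expr1.
Qed.

Lemma monomial_span_affine_exp (g : 'rV[R]_n) c k :
  monomial_span k (fun y => ((g *m y) 0 0 + c) ^+ k).
Proof.
elim: k => [|k IH].
  exists [:: (1, [ffun=> 0%N])]; split=> [t|y].
    rewrite mem_seq1 => /eqP -> /=; rewrite big1// => i _; exact: ffunE.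
  by rewrite big_seq1 expr0 big1 ?mulr1// => i _; rewrite ffunE.
have H1 := monomial_span_sum (index_enum 'I_n)
  (fun i => monomial_spanZ (g 0 i) (monomial_span_coord i IH)).
have H2 := monomial_spanW (leqnSn k) (monomial_spanZ c IH).
have [s [sd sE]] := monomial_spanD H1 H2; exists s; split=> // y.
rewrite -sE exprS mulrDl mxE mulr_suml; congr (_ + _).
by apply: eq_bigr => i _; rewrite mulrA.
Qed.

Lemma monomial_span_affine_horner (g : 'rV[R]_n) c d (p : {poly R}) :
  (size p <= d.+1)%N ->
  monomial_span d (fun y => p.[(g *m y) 0 0 + c]).
Proof.
move=> sp; have H (k : 'I_d.+1) : monomial_span d (fun y =>
  p`_k * ((g *m y) 0 0 + c) ^+ k).
  by apply: monomial_spanZ; apply: monomial_spanW (monomial_span_affine_exp g c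
    k); rewrite -ltnS.
have [s [sd sE]] := monomial_span_sum (index_enum 'I_d.+1) H; exists s;
  split=> // y.
by rewrite -sE (horner_coef_wide _ sp).
Qed.

Lemma monomial_span_polynomial d F : monomial_span d F ->
  polynomial_function d F.
Proof.
move=> [s [sd sE]]; suff [c cE] : polynomial_function d
    (fun y => \sum_(t <- s) t.1 * \prod_i y i 0 ^+ t.2 i).
  by exists c => y; rewrite sE.
elim: s sd {F sE} => [|t s IH] sd.
  by exists (fun=> 0) => y; rewrite big_nil big1// => j _; rewrite mul0r.
have [|c cE] := IH; first by move=> r rs; apply: sd; rewrite in_cons rs orbT.
have td := sd t (mem_head _ _).
have tid i : (t.2 i < d.+1)%N.
  by rewrite ltnS (leq_trans _ td)// (bigD1 i)//= leq_addr.
pose j0 : {ffun 'I_n -> 'I_d.+1} := [ffun i => Ordinal (tid i)].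
have j0d : (\sum_i j0 i <= d)%N.
  by rewrite (eq_bigr (fun i => t.2 i)) => [//|i _]; rewrite ffunE.
pose j : multi_index n d := exist _ j0 j0d.
exists (fun k => (if k == j then t.1 else 0) + c k) => y.
rewrite big_cons cE [in RHS](eq_bigr (fun k =>
  (if k == j then t.1 * monomial k y else 0) + c k * monomial k y)).
  rewrite big_split -big_mkcond big_pred1_eq; congr (_ * _ + _).
  by apply: eq_bigr => i _; rewrite /= ffunE.
by move=> k _; rewrite mulrDl; case: ifP; rewrite ?mul0r.
Qed.

End polynomial_functions.

Lemma shift_poly_scale (R : numFieldType) (p : {poly R}) c f M :
  shift_poly p (fun N => c * f N) M = c * shift_poly p f M.
Proof. by rewrite mulr_sumr; apply: eq_bigr => i _; rewrite mulrCA. Qed.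

Lemma cone_count_translate (R : realType) (n : nat) (xi : 'rV[int]_n)
    (l : seq (ray R n)) v s (z M : int) : Zvec s ->
      dual_rays (map_mx intr xi) l ->
  ((map_mx intr xi : 'rV[R]_n) *m s) 0 0 = z%:~R ->
  cone_count xi l (v + s) M = cone_count xi l v (M - z).
Proof.
move=> sZ lE sE; rewrite /cone_count -[in RHS](npts_shift s);
  last exact: finite_cone_points.
congr (npts _)%:R; apply/seteqP.
have E x : ((map_mx intr xi *m (x - s)) 0 0 <= (M - z)%:~R :> R) =
           ((map_mx intr xi *m x) 0 0 <= M%:~R :> R).
  by rewrite -[s]scale1r form_sub mul1r sE intrB lerD2r.
split=> x [xZ xl xM]; split.
- exact: ZvecB.
- by rewrite -addrA -opprD [s + v]addrC.
- by rewrite E.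
- by rewrite -(subrK s x); exact: ZvecD.
- by rewrite [v + s]addrC opprD addrA.
- by rewrite -E.
Qed.

(** * Lattice points of a bounded polyhedron *)

Section lattice_point_count.
Context {R : realType} {m n : nat}.
Variables (A : 'M[R]_(m, n)) (xi : 'rV[int]_n) (Y : set 'cV[R]_m).
Variables (D D' : signed_cones A).
Local Notation no := (fun _ : 'I_m => false).
Hypothesis goodD : forall j,
  @good_cone _ _ _ A (map_mx intr xi) Y finset.set0 n D j.
Hypothesis goodD' : forall j,
  @good_cone _ _ _ A (map_mx intr (- xi)) Y finset.set0 n D' j.
Hypothesis DE : decomposes Y finset.set0 no D.
Hypothesis D'E : decomposes Y finset.set0 no D'.

Lemma polyhedron_half_open beta x :
  half_open A finset.set0 no beta x = `[< polyhedron A beta x >].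
Proof.
apply/forallP/asboolP => [xP i|xP i]; last by rewrite finset.inE /= xP.
by have := xP i; rewrite finset.inE.
Qed.

(** [D'], built for [- xi], bounds [xi] from above on the polyhedron by its largest value at an
    apex. Beyond that bound the cutoff [M] loses no point of the polyhedron, and elsewhere the cones
    cancel pointwise. *)
Lemma npts_cone_count beta : Y beta -> exists M1 : int, forall M, M1 <= M ->
  (npts (polyhedron A beta `&` @Zvec R n))%:R =
  \sum_j sc_coef j * cone_count xi (sc_rays j) (base_point (@sc_base _ _ _ _ D
    j) beta) M.
Proof.
move=> Yb.
have x0 x i : i \in finset.set0 -> slack A beta x i = 0 by rewrite finset.inE.
have coneP (E : signed_cones A) x : decomposes Y finset.set0 no E ->
  polyhedron A beta x ->
    exists j, cone (sc_rays j) (x - base_point (@sc_base _ _ _ _ E j) beta).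
  move=> EE xP; apply: contrapT => nj.
  have /eqP := EE beta x Yb (x0 x); rewrite polyhedron_half_open asboolT// big1.
    by rewrite oner_eq0.
  move=> j _; case: (boolP (cone _ _)) => [cj|]; rewrite ?mulr0//.
  by case: nj; exists j.
pose bnd j := ((map_mx intr xi :
  'rV[R]_n) *m base_point (@sc_base _ _ _ _ D' j) beta) 0 0.
pose c := \big[Num.max/0]_j bnd j.
exists (Num.ceil c) => M cM.
have xiM x : polyhedron A beta x -> ((map_mx intr xi :
  'rV[R]_n) *m x) 0 0 <= M%:~R.
  move=> /(coneP _ _ D'E)[j]; have [_ _ lE _ _] := goodD' j.
  move=> /(cone_xi_ge0 lE).
  rewrite map_mxN mulNmx mxE oppr_ge0 -[base_point _ _]scale1r form_sub mul1r
    subr_le0.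
  move=> /le_trans; apply; apply: (@le_trans _ _ c);
    first exact: (le_bigmax _ bnd).
  by apply: (le_trans (ceil_ge c)); rewrite ler_int.
pose pts j := cone_points xi (sc_rays j) (base_point (@sc_base _ _ _ _ D j)
  beta) M.
have fpts j : finite_set (pts j) by have [_ _ lE _ _] := goodD j;
  exact: finite_cone_points.
have fU : finite_set (\bigcup_j pts j) by apply: bigcup_finite => // ;
  exact: finite_finset.
pose W := fset_set (\bigcup_j pts j).
have inW x : (exists j, pts j x) -> x \in W.
  by move=> [j jx]; rewrite in_fset_set// mem_set//; exists j.
rewrite (@npts_sum _ _ _ W) => [|x [xP xZ]]; last first.
  have [j cj] := coneP _ _ DE xP; apply: inW; exists j; split=> //.
  exact: xiM.
rewrite [RHS](eq_bigr (fun j => \sum_(x <- W) sc_coef j * `[< pts j x >]%:R));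
  last first.
  move=> j _; rewrite /cone_count (@npts_sum _ _ _ W) ?mulr_sumr// => x jx.
  by apply: inW; exists j.
rewrite exchange_big /= !big_seq; apply: eq_bigr => x;
  rewrite in_fset_set// => /set_mem[j0 _ [xZ _ xM]].
have -> : `[< (polyhedron A beta `&` @Zvec R n) x >] =
  `[< polyhedron A beta x >].
  by apply/asboolP/asboolP => [[]|].
rewrite -polyhedron_half_open DE//; last exact: x0.
apply: eq_bigr => j _; congr (_ * _%:R); congr nat_of_bool.
by apply/idP/asboolP => [|[]].
Qed.

(** Moving apex [j] by an integral vector of [xi]-value [s j] replaces [M] by [M - s j] in its
    count, and [constant_sum_polynomial] applies. *)
Lemma npts_polynomial beta0 : Y beta0 ->
  exists p : sc_index D -> {poly R}, (forall j, size (p j) <= n.+1)%N /\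
    forall beta, Y beta ->
      (forall j, Zvec (base_point (sc_base j) beta - base_point (@sc_base _ _ _
        _ D j) beta0)) ->
      (npts (polyhedron A beta `&` @Zvec R n))%:R =
      \sum_j (p j).[- ((map_mx intr xi : 'rV[R]_n) *m
         (base_point (sc_base j) beta - base_point (sc_base j) beta0)) 0 0].
Proof.
move=> Y0; pose V j beta := base_point (@sc_base _ _ _ _ D j) beta.
pose f j M := sc_coef j * cone_count xi (sc_rays j) (V j beta0) M.
have [|||p [ps pE]] := @constant_sum_polynomial R _ n f (fun j =>
  map (height xi) (sc_rays j)).
- by move=> j; have [_ _ _ js _] := goodD j; rewrite size_map js.
- move=> j; have [_ _ lE _ _] := goodD j; elim: (sc_rays j) lE =>
    //= r l IH [rZ xir _ _ /IH ->].
  by rewrite (heightE rZ xir).1.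
- move=> j; have [_ _ lE _ jb] := goodD j.
  have [|M0 M0E] := @cone_count_killed R n xi (sc_rays j) (V j beta0) lE.
    by move=> r /jb[].
  by exists M0 => M /M0E kE; rewrite shift_poly_scale kE mulr0.
exists p; split=> // beta Yb VZ.
have /choice[s sE] j := xi_int xi (VZ j).
have [M1 M1E] := npts_cone_count Yb.
transitivity (\sum_j (p j).[- (s j)%:~R]); last by apply: eq_bigr => j _;
  rewrite sE.
apply: (pE _ s M1) => M /M1E ->.
apply: eq_bigr => j _; congr (_ * _); have [_ _ lE _ _] := goodD j.
have := cone_count_translate (V j beta0) M (VZ j) lE (sE j).
by rewrite /V addrCA subrr addr0.
Qed.

End lattice_point_count.

(** * Chambers *)

Section parametric_fibers.
Context {R : realType} {m nx ny : nat}.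
Variables (A : 'M[R]_(m, nx)) (B : 'M[R]_(m, ny)) (b : 'cV[R]_m).

Lemma fiberE y : fiber A B b y = polyhedron A (b + B *m y).
Proof.
have sE x i : slack A (b + B *m y) x i = (b + B *m y) i 0 - (A *m x) i 0.
  by rewrite /slack [LHS]mxE [X in _ + X]mxE.
by apply/seteqP; split=> x xP i; have := xP i; rewrite sE subr_ge0.
Qed.

Lemma base_vertexE (I : base A) y : base_vertex B b I y =
  base_point I (b + B *m y).
Proof.
rewrite /base_vertex /base_point mul_rowsub_mx; congr (_ *m _).
by apply/matrixP => i j; rewrite !mxE.
Qed.

Lemma base_vertexB (I : base A) y z :
  base_vertex B b I y - base_vertex B b I z =
  invmx (rowsub (rows_of I) A) *m rowsub (rows_of I) B *m (y - z).
Proof. by rewrite /base_vertex -mulmxBr opprD addrACA subrr add0r -mulmxBr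
  mulmxA. Qed.

Lemma bounded_recession beta (w : 'cV[R]_nx) :
  bounded_set (polyhedron A beta) ->
  polyhedron A beta !=set0 -> (forall i, (A *m w) i 0 <= 0) -> w = 0.
Proof.
move=> [M0 [_ M0E]] [x xP] wA; apply/eqP; apply: contraT => w0.
pose M := `|M0| + 1.
have ltM : M0 < M by rewrite (le_lt_trans (ler_norm M0))// ltrDl.
have bnd z : polyhedron A beta z -> `|z| <= M by exact: M0E.
have nw : 0 < `|w| by rewrite normr_gt0.
(* A step of norm [2 M + 1], more than two points of norm at most [M] can be apart. *)
pose s := (M + M + 1) / `|w|.
have M_ge0 : 0 <= M by rewrite addr_ge0.
have s0 : 0 < s by rewrite divr_gt0// ltr_wpDl ?addr_ge0.
have xsw : polyhedron A beta (x + s *: w).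
  by move=> i; rewrite slackD subr_ge0 (le_trans _ (xP i))// pmulr_rle0.
have : `|s *: w| <= M + M.
  rewrite -[s *: w](addKr x) (le_trans (ler_normD _ _))// normrN lerD ?bnd//.
by rewrite normrZ (gtr0_norm s0) /s divfK ?gt_eqF// gerDl ler10.
Qed.

End parametric_fibers.

Lemma vert_scale (R : realType) (n : nat) (S : set 'cV[R]_n) (r : R) v :
  0 < r ->
  vert S v -> vert ((fun x => r *: x) @` S) (r *: v).
Proof.
move=> r0 [u [t [ut uE]]]; exists u, (r * t); split=> [_ [x xS <-]|].
  by rewrite -scalemxAr mxE ler_pM2l// ut.
have Ev x : [set v] x = (S x /\ (u *m x) 0 0 = t) by rewrite uE.
apply/seteqP; split=> [_ ->|_ [[x xS <-]]].
  have [vS vt] : S v /\ (u *m v) 0 0 = t by rewrite -Ev.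
  by split; [exists v|rewrite -scalemxAr mxE vt].
rewrite -scalemxAr mxE => /(mulfI (lt0r_neq0 r0)) xt.
by have -> : x = v by rewrite -[x = v]/([set v] x) Ev.
Qed.

Lemma ZvecZ (R : realType) (n : nat) (c : R) (x : 'cV[R]_n) :
  c \is a Num.int -> Zvec x -> Zvec (c *: x).
Proof. by move=> cZ /mxOverP xZ; apply/mxOverP => i j; rewrite mxE rpredM. Qed.

Section chambers.
Context {R : realType} {m nx ny N : nat}.
Variables (A : 'M[int]_(m, nx)) (B : 'M[R]_(m, ny)) (b : 'cV[R]_m).
Variables (C : 'M[rat]_(N, ny)) (d : 'cV[rat]_N).
Local Notation AR := (map_mx intr A : 'M[R]_(m, nx)).
Local Notation beta y := (b + B *m y).
Hypothesis sign_classE : forall y z : 'cV[R]_ny,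
  sign_class C d y z -> sign_pattern_sub AR (beta y) (beta z).

Definition chambers : set (set 'cV[R]_ny) :=
  [set closed_cell C d y | y in [set y | fiber AR B b y !=set0]].

Definition chamber_bases (Q : set 'cV[R]_ny) : set (base AR) :=
  [set I | exists2 y, relint Q y & fiber AR B b y (base_vertex B b I y)].

Lemma chamber_basesE y0 y I : sign_class C d y0 y ->
  chamber_bases (closed_cell C d y0) I <-> fiber AR B b y (base_vertex B b I y).
Proof.
move=> y0y; rewrite /chamber_bases /= relint_closed_cell; split;
  last by exists y.
move=> [z y0z]; rewrite !fiberE !base_vertexE => zP i.
have yz := sign_class_trans (sign_class_sym y0y) y0z.
by rewrite (eq_sgr_ge0 (sign_pattern_base_point I i (sign_classE yz))).
Qed.

Lemma chambers_decomposition : chamber_decomposition B b chambers chamber_bases.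
Proof.
split.
- split; first exact: finite_closed_cells.
  by move=> _ [y _ <-]; exact: rational_polyhedron_closed_cell.
- move=> _ _ [y _ <-] [z _ <-]; rewrite !relint_closed_cell => -[w [yw zw]].
  by rewrite (closed_cell_eq yw) (closed_cell_eq zw).
- move=> _ [[x y] xyP <-] /=; exists (closed_cell C d y);
    last by rewrite relint_closed_cell.
  by exists y => //; exists x.
- move=> _ [y _ <-] z w; rewrite relint_closed_cell => yz yw; rewrite !fiberE.
  have zw := sign_class_trans (sign_class_sym yz) yw.
  by apply: sign_pattern_combinatorial_type; apply: sign_classE => //;
    exact: sign_class_sym.
- move=> _ [y _ <-] z; rewrite relint_closed_cell => yz.
  rewrite fiberE vert_polyhedron; apply/seteqP; split=> _ [I IP <-].
    exists I; last exact: base_vertexE.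
    by apply/(chamber_basesE I yz); rewrite fiberE base_vertexE.
  exists I; last by rewrite base_vertexE.
  by move/(chamber_basesE I yz): IP; rewrite fiberE base_vertexE.
Qed.

(** The slacks at a base vertex are affine along the segment from [y] to [y0] and nonnegative on all
    of it except possibly at [y], hence also there. *)
Lemma chamber_bases_closed y0 y I : closed_cell C d y0 y ->
  chamber_bases (closed_cell C d y0) I -> fiber AR B b y (base_vertex B b I y).
Proof.
move=> yQ IQ; rewrite fiberE base_vertexE => i.
pose g s := slack AR (beta (y + s *: (y0 - y))) (base_point I (beta (y + s *:
  (y0 - y)))) i.
have g_ge0 s : 0 < s -> s <= 1 -> 0 <= g s.
  move=> s0 s1; have ys : sign_class C d y0 (y + s *: (y0 - y)) by exact:
    closed_cell_segment.
  by move/(chamber_basesE I ys): IQ; rewrite fiberE base_vertexE; apply.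
have gE s : g s = g 0 + s * (g 1 - g 0).
  rewrite /g -!base_vertexE /slack !scale0r !addr0 !scale1r.
  have -> : base_vertex B b I (y + s *: (y0 - y)) =
    base_vertex B b I y + s *: (base_vertex B b I y0 - base_vertex B b I y).
    rewrite -[LHS](subrK (base_vertex B b I y)) !base_vertexB.
    by rewrite [y + _ - y]addrC addKr -scalemxAr addrC.
  rewrite [y + (y0 - y)]addrC subrK !mulmxDr -!scalemxAr !mulmxBr !mxE; ring.
suff : 0 <= g 0 by rewrite /g scale0r addr0.
rewrite leNgt; apply/negP => g0.
have g1 : 0 <= g 1 by exact: g_ge0.
have den : 0 < g 1 - g 0 by lra.
(* Half the zero of the affine function [g], where its value is [g 0 / 2 < 0]. *)
pose s := - g 0 / (g 1 - g 0) / 2.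
have sE : s * (g 1 - g 0) = - g 0 / 2 by rewrite /s; field; rewrite gt_eqF.
have s0 : 0 < s by rewrite !divr_gt0// oppr_gt0.
have s1 : s <= 1 by nra.
have := g_ge0 s s0 s1; rewrite gE sE; lra.
Qed.

Definition vertices_congruent (Q : set 'cV[R]_ny) (u v : 'cV[R]_ny) : Prop :=
  forall I, chamber_bases Q I ->
    Zvec (base_vertex B b I u - base_vertex B b I v).

Lemma vertices_congruent_sym Q u v : vertices_congruent Q u v ->
  vertices_congruent Q v u.
Proof. by move=> uv I IQ; rewrite -opprB; exact/ZvecN/uv. Qed.

Lemma vertices_congruent_trans Q u v w :
  vertices_congruent Q u v -> vertices_congruent Q v w ->
    vertices_congruent Q u w.
Proof.
move=> uv vw I IQ.
by rewrite -(subrK (base_vertex B b I v) (base_vertex B b I u)) -addrA;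
  apply: ZvecD; [exact: uv|exact: vw].
Qed.

(** One cone decomposition serves the whole sign class. As the vertices stay fixed modulo the
    lattice, [npts_polynomial] gives polynomials of degree at most [nx] in affine functions of
    [y]. *)
Lemma count_class_polynomial y0 u : fiber AR B b y0 !=set0 ->
  (exists2 y, sign_class C d y0 y & bounded_set (fiber AR B b y)) ->
  exists c : multi_index ny nx -> R, forall y, sign_class C d y0 y ->
    vertices_congruent (closed_cell C d y0) y u ->
    (count_points AR B b y)%:R = \sum_j c j * monomial j y.
Proof.
move=> [x0 x0P] [y1 y01 bnd].
have [[y2 y02 y2u]|ny2] := pselect (exists2 y2, sign_class C d y0 y2 &
    vertices_congruent (closed_cell C d y0) y2 u); last first.
  by exists (fun=> 0) => y y0y yu; case: ny2; exists y.
(* The recession cone is the same for all right-hand sides and is trivial because the fiber over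
   [y1] is bounded; that fiber contains a point with the signs of [x0]. *)
have rec0 (w : 'cV[R]_nx) : (forall i, (AR *m w) i 0 <= 0) -> w = 0.
  apply: (@bounded_recession _ _ _ AR (beta y1)); first by rewrite -fiberE.
  have [x' x'E] := sign_classE y01 x0; exists x' => i;
    rewrite -(eq_sgr_ge0 (x'E i)).
  by move: x0P; rewrite fiberE; apply.
have [xi xiE] := generic_functional A.
have xi_generic (K : {set 'I_m}) : (#|K| < nx)%N ->
  exists2 w : 'cV[R]_nx, Zvec w
    & (forall i, i \in K -> (AR *m w) i 0 = 0) /\ 0 < ((map_mx intr xi :
      'rV[R]_nx) *m w) 0 0.
  move=> /xiE[w wK xiw]; exists (map_mx intr w); first by apply/ZvecP; exists w.
  split=> [i iK|]; first by rewrite -map_mxM [LHS]mxE wK.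
  by rewrite -map_mxM mxE ltr0z.
have xiN_generic (K : {set 'I_m}) : (#|K| < nx)%N ->
  exists2 w : 'cV[R]_nx, Zvec w
    & (forall i, i \in K -> (AR *m w) i 0 = 0) /\ 0 < ((map_mx intr (- xi) :
      'rV[R]_nx) *m w) 0 0.
  move=> /xi_generic[w wZ [wK xiw]]; exists (- w); first exact: ZvecN.
  by split=> [i iK|]; [rewrite mulmxN mxE wK ?oppr0|rewrite map_mxN mulmxN
    mulNmx opprK].
pose Y : set 'cV[R]_m := [set beta y | y in sign_class C d y0].
have sgY (I : base AR) i bt bt' : Y bt -> Y bt' ->
    Num.sg (slack AR bt (base_point I bt) i) =
      Num.sg (slack AR bt' (base_point I bt') i).
  move=> [y y0y <-] [y' y0y' <-]; apply: sign_pattern_base_point;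
    apply: sign_classE.
  exact: sign_class_trans (sign_class_sym y0y) y0y'.
have dn : (nx + #|finset.set0 : {set 'I_m}|)%N = nx by rewrite cards0 addn0.
have [D [goodD DE]] := polyhedron_decomposition xi_generic rec0 sgY (fun=>
  false) dn (indep_rows0 (A := AR)).
have [D' [goodD' D'E]] := polyhedron_decomposition xiN_generic rec0 sgY (fun=>
  false) dn (indep_rows0 (A := AR)).
have Y2 : Y (beta y2) by exists y2.
have [p [ps pE]] := npts_polynomial goodD goodD' DE D'E Y2.
have jQ (j : sc_index D) : chamber_bases (closed_cell C d y0) (sc_base j).
  have [_ jP _ _ _] := goodD j; apply/(chamber_basesE _ y02).
  by rewrite fiberE base_vertexE; apply: jP.
pose L j := - ((map_mx intr xi :
  'rV[R]_nx) *m (invmx (rowsub (rows_of (sc_base j)) AR) *m rowsub (rows_of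
    (@sc_base _ _ _ _ D j)) B)).
have spanE j := monomial_span_affine_horner (L j) (- (L j *m y2) 0 0) (ps j).
have [c cE] := monomial_span_polynomial (monomial_span_sum (index_enum _)
  spanE).
exists c => y y0y yu; rewrite -cE.
have yE : vertices_congruent (closed_cell C d y0) y y2.
  exact: vertices_congruent_trans yu (vertices_congruent_sym y2u).
rewrite /count_points fiberE -/(npts _) (pE (beta y)); last 2 first.
- by exists y.
- by move=> j; rewrite -!base_vertexE; apply: yE.
apply: eq_bigr => j _; congr (_.[_]).
rewrite -!base_vertexE base_vertexB mulmxA /L !mulNmx !mulmxBr.
by rewrite !mxE; ring.
Qed.

End chambers.

Theorem theorem5 (R : realType) (m nx ny : nat)
    (A : 'M[int]_(m, nx)) (B : 'M[rat]_(m, ny)) (b : 'cV[rat]_m) :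
  let AR : 'M[R]_(m, nx) := map_mx intr A in
  let BR : 'M[R]_(m, ny) := map_mx ratr B in
  let bR : 'cV[R]_m := map_mx ratr b in
  exists (QS : set (set 'cV[R]_ny)) (bases : set 'cV[R]_ny -> set (base AR)),
    chamber_decomposition BR bR QS bases /\
    forall Q : set 'cV[R]_ny, QS Q ->
      (exists2 y, relint Q y & bounded_set (fiber AR BR bR y)) ->
      exists a : multi_index ny nx -> 'cV[R]_ny -> R,
        [/\ forall y, relint Q y ->
              (count_points AR BR bR y)%:R
                = \sum_(j : multi_index ny nx) a j y * monomial j y,
            forall j, is_periodic (a j),
            forall q : rat, is_chdenom BR bR (bases Q) q ->
              forall j, period_vector (const_mx (ratr q)) (a j)
          & forall y z : 'cV[R]_ny, Q y -> relint Q z ->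
              forall dy dz q : rat,
                is_denom (fiber AR BR bR y) dy ->
                is_denom (fiber AR BR bR z) dz ->
                is_lcmq dy dz q ->
                forall j, a j y = a j (y + ratr q *: (z - y))].
Proof.
move=> AR BR bR.
have [L LE] := sign_pattern_elimination R (map_mx intr A : 'M[rat]_(m, nx)).
(* The eliminated forms evaluated at [b + B y] become the affine forms in [y] that define the
   arrangement. *)
pose C := \matrix_(k < size L) (nth 0 L k *m B).
pose d : 'cV[rat]_(size L) := \col_k (nth 0 L k *m b) 0 0.
have formsE y (k : 'I_(size L)) : forms C d y k 0 =
  (map_mx ratr (nth 0 L k) *m (bR + BR *m y)) 0 0.
  rewrite mulmxDr mulmxA -!map_mxM [RHS]mxE [LHS]mxE addrC; congr (_ + _).
    by rewrite !mxE.
  by rewrite !mxE; apply: eq_bigr => j _; rewrite !mxE.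
have classE (y z : 'cV[R]_ny) : sign_class C d y z ->
    sign_pattern_sub AR (bR + BR *m y) (bR + BR *m z).
  move=> yz x; have [u uL|x' x'E] := LE (bR + BR *m y) (bR + BR *m z) _ x.
    have uk : (index u L < size L)%N by rewrite index_mem.
    by have := yz (Ordinal uk); rewrite !formsE /= nth_index.
  exists x' => i; rewrite /slack; have := x'E i.
  suff -> : map_mx ratr (map_mx intr A : 'M[rat]_(m, nx)) = AR by [].
  by apply/matrixP => k l; rewrite !mxE ratr_int.
exists (chambers A BR bR C d), (@chamber_bases _ _ _ _ A BR bR).
split; first exact: chambers_decomposition.
move=> _ [y0 y0P <-]; set Q := closed_cell C d y0.
have relintQ : relint Q = sign_class C d y0 by exact: relint_closed_cell.
rewrite relintQ => bnd.
pose cong := vertices_congruent A BR bR Q.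
(* The choice made by [xget] depends on the set [coefs u] only, so parameters with congruent
   vertices get equal coefficients, also outside the relative interior. *)
pose coefs u : set (multi_index ny nx -> R) := [set c | forall y,
  sign_class C d y0 y -> cong y u ->
  (count_points AR BR bR y)%:R = \sum_j c j * monomial j y].
pose a j u := xget (fun=> 0) (coefs u) j.
have aE u : coefs u (fun j => a j u).
  have [c cE] := count_class_polynomial classE u y0P bnd.
  exact: (@xgetPex _ (fun=> 0) (coefs u) (ex_intro _ c cE)).
have aC u v : cong u v -> forall j, a j u = a j v.
  move=> uv j; rewrite /a; suff -> : coefs u = coefs v by [].
  apply/seteqP; split=> c cE y y0y yu; apply: cE => //.
    by apply: vertices_congruent_trans yu (vertices_congruent_sym uv).
  by apply: vertices_congruent_trans yu uv.
exists a; split.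
- by move=> y y0y; apply: aE => // I _; rewrite subrr; apply/mxOverP => i j;
    rewrite mxE rpred0.
(* A matrix with no columns only asks for equality when [u - v] is zero; actual periods come with
   the next claim. *)
- move=> j; exists 0%N, 0; split=> [|u v [k _]]; first by rewrite mxrank0.
  by rewrite mul0mx => /eqP; rewrite subr_eq0 => /eqP ->.
- move=> q [[q0 qZ] _] j; split.
    rewrite diag_const_mx mxrank_unit// unitmxE det_scalar unitrX// unitfE.
    by rewrite fmorph_eq0 gt_eqF.
  move=> u v [k kZ uvE]; apply: aC => I IQ.
  rewrite base_vertexB uvE diag_const_mx mul_scalar_mx -scalemxAr.
  (* The vertex moves by [q] times the difference of its positions at the integral parameters [k]
     and 0. *)
  have := ZvecB (qZ k I kZ IQ) (qZ 0 I _ IQ);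
    rewrite -scalerBr base_vertexB subr0.
  by apply; apply/mxOverP => i l; rewrite mxE rpred0.
move=> y z Qy y0z dy dz q [[dy0 dyZ] _] [[dz0 dzZ] _] [[q0 qdy qdz] _] j.
apply: aC => I IQ; rewrite -opprB; apply: ZvecN.
(* By affinity the vertex moves by [q] times its position at [z] minus [q] times its position at
   [y]. Both are integral, as [q] is a multiple of both denominators and the base is feasible at [z]
   and, on the closed chamber, at [y]. *)
rewrite base_vertexB addrC addKr -scalemxAr -(base_vertexB _ bR) scalerBr.
have qI w (dw : rat) : 0 < dw -> q / dw \is a Num.int ->
    vert ((fun x => ratr dw *: x) @` fiber AR BR bR w) `<=` @Zvec R nx ->
    fiber AR BR bR w (base_vertex BR bR I w) ->
      Zvec (ratr q *: base_vertex BR bR I w).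
  move=> dw0 qdw dwZ wP; rewrite -(divfK (lt0r_neq0 dw0) q) rmorphM /= -scalerA.
  apply: ZvecZ; first by case/intrP: qdw => t ->; rewrite ratr_int intr_int.
  apply: dwZ; apply: vert_scale; first by rewrite ltr0q.
  by move: wP; rewrite fiberE base_vertexE; exact: base_point_vert.
apply: ZvecB.
  by apply: (qI z dz) => //; apply/(chamber_basesE classE I y0z).
by apply: (qI y dy) => //; exact: (chamber_bases_closed classE Qy IQ).
Qed.
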